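(* Let $(X,\mathscr A,\mu)$ be a $\sigma$-finite measure space, $w\colon X\to\mathbb C$ an $\mathscr A$-measurable function and $\phi\colon X\to X$ an $\mathscr A$-measurable transformation such that $\mu_w\circ\phi^{-1}\ll\mu$. Let $\alpha\in(0,1]$. Suppose that the weighted composition operator $C_{\phi,w}$ in $L^2(\mu)$ is densely defined. Then the following conditions are satisfied: (i) $\mathcal D(\Delta_\alpha(C_{\phi,w}))=L^2\Big(\big(1+\mathsf h_{\phi,w}^{1-\alpha}+(\mathsf E_{\phi,w}(\mathsf h_{\phi,w}^\alpha)\circ\phi^{-1})\,\mathsf h_{\phi,w}^{1-\alpha}\big)\,\mathrm d\mu\Big)$; (ii) $\Delta_\alpha(C_{\phi,w})\subseteq C_{\phi,w_\alpha}$, where $w_\alpha\colon X\to\mathbb C$ is an $\mathscr A$-measurable function with $w_\alpha=w\cdot\Big(\frac{\mathsf h_{\phi,w}}{\mathsf h_{\phi,w}\circ\phi}\Big)^{\alpha/2}$ a.e. $[\mu]$; (iii) $\Delta_\alpha(C_{\phi,w})$ is closable and $\overline{\Delta_\alpha(C_{\phi,w})}=C_{\phi,w_\alpha}$; (iv) $\Delta_\alpha(C_{\phi,w})=C_{\phi,w_\alpha}$ if and only if $\mathsf h_{\phi,w}^{1-\alpha}\leqslant c\Big(1+(\mathsf E_{\phi,w}(\mathsf h_{\phi,w}^\alpha)\circ\phi^{-1})\,\mathsf h_{\phi,w}^{1-\alpha}\Big)$ a.e. $[\mu]$ for a positive constant $c$; (v) $\Delta_\alpha(C_{\phi,w})$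 is closed if and only if $\mathsf h_{\phi,w}^{1-\alpha}\leqslant c\Big(1+(\mathsf E_{\phi,w}(\mathsf h_{\phi,w}^\alpha)\circ\phi^{-1})\,\mathsf h_{\phi,w}^{1-\alpha}\Big)$ a.e. $[\mu]$ for a positive constant $c$.
   Context: $\overline{\mathbb R}_+=[0,\infty]$. A transformation $\phi\colon X\to X$ is $\mathscr A$-measurable if $\phi^{-1}(\Delta)\in\mathscr A$ for all $\Delta\in\mathscr A$. $\mu_w(\Delta)=\int_\Delta|w|^2\,\mathrm d\mu$ and $\mu_w\circ\phi^{-1}(\Delta)=\mu_w(\phi^{-1}(\Delta))$ for $\Delta\in\mathscr A$. If $\mu_w\circ\phi^{-1}\ll\mu$, then $\mathsf h_{\phi,w}\colon X\to\overline{\mathbb R}_+$ is the ($\mu$-a.e. unique) Radon–Nikodym derivative: $\mu_w\circ\phi^{-1}(\Delta)=\int_\Delta\mathsf h_{\phi,w}\,\mathrm d\mu$, $\Delta\in\mathscr A$, and the weighted composition operator $C_{\phi,w}$ in $L^2(\mu)$ is defined by $\mathcal D(C_{\phi,w})=\{f\in L^2(\mu)\colon w\cdot(f\circ\phi)\in L^2(\mu)\}$, $C_{\phi,w}f=w\cdot(f\circ\phi)$; it is a closed operator and it is densely defined iff $\mathsf h_{\phi,w}<\infty$ a.e. $[\mu]$. Assuming $\mathsf h_{\phi,w}<\infty$ a.e. $[\mu]$, $\mu_w|_{\phi^{-1}(\mathscr A)}$ is $\sigma$-finite, and $\mathsf E_{\phi,w}(f)$ denotes the conditional expectation of $f$ with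 respect to the $\sigma$-algebra $\phi^{-1}(\mathscr A)=\{\phi^{-1}(\Delta)\colon\Delta\in\mathscr A\}$ and the measure $\mu_w$, for $\mathscr A$-measurable $f\colon X\to\overline{\mathbb R}_+$ or $f\in L^p(\mu_w)$, $p\in[1,\infty]$. For such $f$, $\mathsf E_{\phi,w}(f)\circ\phi^{-1}$ denotes the ($\mu$-a.e. unique) $\mathscr A$-measurable function $g$ on $X$ such that $\mathsf E_{\phi,w}(f)=g\circ\phi$ a.e. $[\mu_w]$ and $g=g\cdot\chi_{\{\mathsf h_{\phi,w}>0\}}$ a.e. $[\mu]$. One has $\mathsf h_{\phi,w}\circ\phi>0$ a.e. $[\mu_w]$, so the formula for $w_\alpha$ makes sense a.e. on $\{w\neq0\}$; $w_\alpha=0$ a.e. on $\{w=0\}$. Moreover $\mu_{w_\alpha}\circ\phi^{-1}\ll\mu$, so $C_{\phi,w_\alpha}$ is defined. For a closed densely defined operator $A$ with polar decomposition $A=U|A|$ and $\alpha\in(0,1]$, the $\alpha$-Aluthge transform of $A$ is $\Delta_\alpha(A)=|A|^\alpha U|A|^{1-\alpha}$ (with its natural domain as a product of operators; $|A|^0$ is the identity). $\mathcal D(A)$ is the domain and $\bar A$ the closure of $A$; $A\subseteq B$ means $B$ extends $A$. For measurable $\rho\colon X\to[1,\infty]$, $L^2(\rho\,\mathrm d\mu)=\{f\in L^2(\mu)\colon\int_X|f|^2\rho\,\mathrm d\mu<\infty\}$ (with $0\cdot\infty=0$). *)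

(* Defs.v *)
From HB Require Import structures.
From mathcomp Require Import all_boot all_order all_algebra.
From mathcomp Require Import all_classical all_reals all_analysis.
From mathcomp Require Import measurable_realfun complex ring lra.

Set Implicit Arguments.
Unset Strict Implicit.
Unset Printing Implicit Defensive.

Import Order.TTheory GRing.Theory Num.Theory.
Import numFieldNormedType.Exports ComplexField Normc.

Local Open Scope classical_set_scope.
Local Open Scope complex_scope.
Local Open Scope ring_scope.

Local Notation Re := complex.Re.
Local Notation Im := complex.Im.

HB.mixin Record NormedModule_isInnerProduct (R : realType) H
    & NormedModule R[i] H := {
  dot : H -> H -> R[i];
  dotPl : forall a x y z, dot (a *: x + y) z = a * dot x z + dot y z;
  dotC : forall x y, dot y x = conjc (dot x y);
  dot_norm : forall x, dot x x = `|x| ^+ 2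
}.

#[short(type="innerProdType")]
HB.structure Definition InnerProduct (R : realType) :=
  {H of NormedModule R[i] H & NormedModule_isInnerProduct R H}.

(* A (possibly unbounded, partially defined) operator in H is identified with
   its graph, so that extension is inclusion of sets, and products of operators
   automatically carry their natural domains. *)
Section operators.
Context (R : realType) (H : innerProdType R).
Implicit Types (A B P Q : set (H * H)) (U : H -> H).

Definition opdom A : set H := [set x | exists y, A (x, y)].

Definition single_valued A := forall x y z, A (x, y) -> A (x, z) -> y = z.

Definition linear_operator A :=
  [/\ single_valued A, A (0, 0) &
      forall (a : R[i]) p q, A p -> A q -> A (a *: p + q)].

Definition densely_defined A := dense (opdom A).

Definition closable A := single_valued (closure A).

Definition opcomp A B : set (H * H) :=
  [set p | exists2 y, B (p.1, y) & A (y, p.2)].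

Definition opgraph U : set (H * H) := [set p | p.2 = U p.1].

Definition adjoint A : set (H * H) :=
  [set q | forall p, A p -> dot p.2 q.1 = dot p.1 q.2].

(* E is a projection-valued measure on the Borel sets of R concentrated on
   [0, +oo[, and m x = <E(-) x, x>; countable additivity of E is the fact that
   each m x is a measure. *)
Definition spectral_measure (E : set (measurableTypeR R) -> H -> H)
    (m : H -> {measure set (measurableTypeR R) -> \bar R}) :=
  [/\ forall D, measurable D ->
        [/\ linear (E D), forall x, E D (E D x) = E D x &
            forall x y, dot (E D x) y = dot x (E D y)],
      forall x, E `[0, +oo[%classic x = x &
      forall x D, measurable D -> m x D = (Re (dot (E D x) x))%:E].

(* T is the integral of f with respect to the spectral measure whose scalar
   measures are m: it has domain {x | \int f^2 dm_x < oo} and there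
   <T x, x> = \int f dm_x, which determines T by polarization. *)
Definition spectral_integral
    (m : H -> {measure set (measurableTypeR R) -> \bar R})
    (f : R -> R) (T : set (H * H)) :=
  [/\ linear_operator T,
      opdom T = [set x | (\int[m x]_t (f t ^+ 2)%:E < +oo)%E] &
      forall x y, T (x, y) -> dot y x = (\int[m x]_t f t)%:C].

(* Since powR t 0 = 1 for every t, including t = 0, the zeroth power is the
   identity operator. *)
Definition is_oppower P (a : R) Q :=
  exists E m, [/\ spectral_measure E m, spectral_integral m id P &
                  spectral_integral m (fun t => t `^ a) Q].

(* The power P^a of a positive selfadjoint P, characterized uniquely by
   is_oppower (a junk value for other P). *)
Definition oppower P (a : R) : set (H * H) := get (is_oppower P a).

Definition opabs A := oppower (opcomp (adjoint A) A) 2^-1.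

Definition partial_isometry U :=
  [/\ linear U, continuous U &
      forall x, (forall y, U y = 0 -> dot x y = 0) -> `|U x| = `|x|].

Definition is_polar_part A U :=
  [/\ partial_isometry U, forall x, U x = 0 <-> A (x, 0) &
      A = opcomp (opgraph U) (opabs A)].

(* The partial isometry U of the polar decomposition A = U |A| of a closed
   densely defined A (a junk value for other A). *)
Definition polar_part A : H -> H := get (is_polar_part A).

Definition aluthge (a : R) A :=
  opcomp (oppower (opabs A) a)
    (opcomp (opgraph (polar_part A)) (oppower (opabs A) (1 - a))).

End operators.

Definition sqmod (R : realType) (z : R[i]) : R := normc z ^+ 2.

Section square_integrable.
Context d (X : measurableType d) (R : realType).
Variable mu : {measure set X -> \bar R}.

Definition cmeasurable (f : X -> R[i]) :=
  measurable_fun setT (fun x => Re (f x)) /\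
  measurable_fun setT (fun x => Im (f x)).

Definition square_integrable (f : X -> R[i]) :=
  cmeasurable f /\ (\int[mu]_x (sqmod (f x))%:E < +oo)%E.

Definition l2pred : {pred X -> R[i]} := mem [set f | square_integrable f].

Lemma sqmodE (z : R[i]) : sqmod z = Re z ^+ 2 + Im z ^+ 2.
Proof.
by rewrite /sqmod; case: z => a b /=; rewrite sqr_sqrtr// addr_ge0// sqr_ge0.
Qed.

Lemma sqmodP (a u v : R[i]) :
  sqmod (a * u + v) <= 2 * sqmod a * sqmod u + 2 * sqmod v.
Proof.
case: a => a b; case: u => u v'; case: v => s t; rewrite !sqmodE /=.
rewrite -subr_ge0 [leRHS](_ : _ =
  (a * u - b * v' - s) ^+ 2 + (a * v' + b * u - t) ^+ 2); last by ring.
by rewrite addr_ge0// sqr_ge0.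
Qed.

Lemma measurable_sqmod f : cmeasurable f ->
  measurable_fun setT (EFin \o (fun x => sqmod (f x))).
Proof.
case=> mr mi; apply/measurable_EFinP.
under eq_fun do rewrite sqmodE.
by apply: measurable_funD; apply: measurable_funX.
Qed.

Lemma cmeasurableP (a : R[i]) f g : cmeasurable f -> cmeasurable g ->
  cmeasurable (a *: f + g).
Proof.
move=> [fr fi] [gr gi]; case: a => a b; split.
- rewrite (_ : (fun _ => _) =
    (fun x => a * Re (f x) - b * Im (f x) + Re (g x))); last first.
    by apply/funext => x; rewrite /= /GRing.scale /GRing.add /=;
       case: (f x) => ? ?; case: (g x).
  apply: measurable_funD => //; apply: measurable_funB => //;
  by apply: measurable_funM => //; exact: measurable_cst.
- rewrite (_ : (fun _ => _) =
    (fun x => a * Im (f x) + b * Re (f x) + Im (g x))); last first.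
    by apply/funext => x; rewrite /= /GRing.scale /GRing.add /=;
       case: (f x) => ? ?; case: (g x).
  apply: measurable_funD => //; apply: measurable_funD => //;
  by apply: measurable_funM => //; exact: measurable_cst.
Qed.

Lemma cmeasurable0 : cmeasurable 0.
Proof. by split; exact: measurable_cst. Qed.

Lemma square_integrableE f : square_integrable f <->
  cmeasurable f /\ mu.-integrable setT (EFin \o (fun x => sqmod (f x))).
Proof.
have fE : (fun x => (sqmod (f x))%:E) =
    (fun x => `|(EFin \o (fun x => sqmod (f x))) x|%E).
  by apply/funext => x; rewrite /= ger0_norm// sqr_ge0.
split=> -[mf foo]; split=> //.
  by apply/integrableP; split; [exact: measurable_sqmod|rewrite -fE].
by move/integrableP : foo => [_]; rewrite -fE.
Qed.

Lemma square_integrableP (a : R[i]) f g :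
  square_integrable f -> square_integrable g -> square_integrable (a *: f + g).
Proof.
move=> /square_integrableE[mf fi] /square_integrableE[mg gi].
have mfg := cmeasurableP a mf mg.
apply/square_integrableE; split=> //.
apply: (le_integrable measurableT (measurable_sqmod mfg) _
  (integrableD measurableT (integrableZl measurableT (2 * sqmod a) fi)
                           (integrableZl measurableT 2 gi))) => x _.
rewrite -!EFinM -EFinD lee_fin !ger0_norm ?sqr_ge0//.
  exact: sqmodP.
by rewrite addr_ge0// mulr_ge0 ?sqr_ge0// mulr_ge0 ?sqr_ge0.
Qed.

Lemma l2pred_submod_closed : submod_closed l2pred.
Proof.
split; first rewrite inE /=; first split; first exact: cmeasurable0.
  rewrite integral0_eq// => x _.
  by rewrite sqmodE/= expr0n/= addr0.
by move=> a f g; rewrite !inE /=; exact: square_integrableP.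
Qed.

HB.instance Definition _ :=
  GRing.isSubmodClosed.Build R[i] (X -> R[i]) l2pred l2pred_submod_closed.

Record l2fun := L2Fun { l2fun_val :> X -> R[i]; l2funP : l2fun_val \in l2pred }.

HB.instance Definition _ := [isSub for l2fun_val].
HB.instance Definition _ := [Choice of l2fun by <:].
HB.instance Definition _ := [SubChoice_isSubLmodule of l2fun by <:].

Definition l2null : {pred l2fun} := mem [set f : l2fun | f = 0 %[ae mu]].

Lemma l2null_zmod_closed : zmod_closed l2null.
Proof.
split; first by rewrite inE /=; exact: aeW.
move=> f g; rewrite !inE /=; apply: filterS2 => x /= f0 g0 _.
by rewrite /GRing.add /GRing.opp /= f0// g0// subrr.
Qed.

HB.instance Definition _ :=
  GRing.isZmodClosed.Build l2fun l2null l2null_zmod_closed.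

(* Functions equal mu-almost everywhere are identified. *)
Definition L2 : Type := Quotient.quot l2null.
HB.instance Definition _ := Choice.on L2.
HB.instance Definition _ := GRing.Zmodule.on L2.
HB.instance Definition _ := EqQuotient.on L2.

Definition L2_fun (f : L2) : X -> R[i] := repr f.
Local Coercion L2_fun : L2 >-> Funclass.

Lemma L2_eqP (f g : L2) : ((f : X -> R[i]) = g %[ae mu]) <-> f = g.
Proof.
split=> [fg|->]; last exact: aeW.
apply/eqP; rewrite -[f]reprK -[g]reprK -Quotient.idealrBE inE /=.
by apply: filterS fg => x /= fg _; apply/eqP; rewrite subr_eq0; exact/eqP/fg.
Qed.

Lemma L2_piE (f : l2fun) : L2_fun (\pi_L2 f)%qT = f %[ae mu].
Proof.
have : repr (\pi_L2 f)%qT - f \in l2null by rewrite Quotient.idealrBE reprK.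
rewrite inE /=; apply: filterS => x /= + _ => /(_ I) /eqP.
by rewrite subr_eq0 => /eqP.
Qed.

Lemma L2_addE (f g : L2) :
  L2_fun (f + g) = (fun x => f x + g x) %[ae mu].
Proof.
have -> : f + g = (\pi_L2 (repr f + repr g))%qT.
  rewrite -{1}[f]reprK -{1}[g]reprK; apply/esym.
  exact: (@Quotient.pi_add _ l2null).
exact: L2_piE.
Qed.

Definition L2_scale (a : R[i]) (f : L2) : L2 := (\pi_L2 (a *: repr f))%qT.

Lemma L2_scaleE (a : R[i]) (f : L2) :
  L2_fun (L2_scale a f) = (fun x => a * f x) %[ae mu].
Proof. exact: L2_piE. Qed.

Lemma L2_scaleA a b f : L2_scale a (L2_scale b f) = L2_scale (a * b) f.
Proof.
have h1 := L2_scaleE a (L2_scale b f); have h2 := L2_scaleE b f.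
have h3 := L2_scaleE (a * b) f.
apply/L2_eqP; near=> x => _.
by rewrite (near h1 x)// (near h2 x)// (near h3 x)// mulrA.
Unshelve. all: by end_near. Qed.

Lemma L2_scale1 : left_id 1 L2_scale.
Proof.
move=> f; apply/L2_eqP; move: (L2_scaleE 1 f).
by apply: filterS => x /= + _ => ->//; rewrite mul1r.
Qed.

Lemma L2_scaleDr : right_distributive L2_scale +%R.
Proof.
move=> a f g.
have h1 := L2_scaleE a f; have h2 := L2_scaleE a g.
have h3 := L2_addE (L2_scale a f) (L2_scale a g).
have h4 := L2_scaleE a (f + g); have h5 := L2_addE f g.
apply/L2_eqP; near=> x => _.
rewrite (near h4 x)// (near h3 x)//= (near h5 x)//= (near h1 x)// (near h2 x)//.
by rewrite mulrDr.
Unshelve. all: by end_near. Qed.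

Lemma L2_scaleDl f : {morph L2_scale^~ f : a b / a + b}.
Proof.
move=> a b.
have h1 := L2_scaleE a f; have h2 := L2_scaleE b f.
have h3 := L2_addE (L2_scale a f) (L2_scale b f).
have h4 := L2_scaleE (a + b) f.
apply/L2_eqP; near=> x => _.
by rewrite (near h4 x)// (near h3 x)//= (near h1 x)// (near h2 x)// mulrDl.
Unshelve. all: by end_near. Qed.

HB.instance Definition _ := GRing.Zmodule_isLmodule.Build R[i] L2
  L2_scaleA L2_scale1 L2_scaleDr L2_scaleDl.

Lemma L2P (f : L2) : square_integrable f.
Proof. by have := l2funP (repr f); rewrite inE. Qed.

Let rpart (f g : X -> R[i]) x : R := Re (f x) * Re (g x) + Im (f x) * Im (g x).
Let ipart (f g : X -> R[i]) x : R := Im (f x) * Re (g x) - Re (f x) * Im (g x).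

Lemma cross_term_le (a b c e : R) :
  `|a * c + b * e| <= a ^+ 2 + b ^+ 2 + (c ^+ 2 + e ^+ 2).
Proof.
have := sqr_ge0 (a + c); have := sqr_ge0 (b + e).
have := sqr_ge0 (a - c); have := sqr_ge0 (b - e).
have := sqr_ge0 a; have := sqr_ge0 b; have := sqr_ge0 c; have := sqr_ge0 e.
by rewrite ler_norml => *; apply/andP; split; lra.
Qed.

Lemma L2_mul_integrable (f g : L2) :
  mu.-integrable setT (EFin \o (fun x => Re (f x * conjc (g x)))) /\
  mu.-integrable setT (EFin \o (fun x => Im (f x * conjc (g x)))).
Proof.
have /square_integrableE[[fr fi] f2] := L2P f.
have /square_integrableE[[gr gi] g2] := L2P g.
have RE x : Re (f x * conjc (g x)) = rpart f g x.
  by rewrite /rpart; case: (f x) => a b; case: (g x) => c e /=; ring.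
have IE x : Im (f x * conjc (g x)) = ipart f g x.
  by rewrite /ipart; case: (f x) => a b; case: (g x) => c e /=; ring.
have fg2 := integrableD measurableT f2 g2.
split; apply: (le_integrable measurableT _ _ fg2).
- under [X in measurable_fun _ X]eq_fun do rewrite /= RE.
  by apply/measurable_EFinP; apply: measurable_funD; apply: measurable_funM.
- move=> x _; rewrite -EFinD lee_fin RE /rpart [leRHS]ger0_norm.
    by rewrite !sqmodE; exact: cross_term_le.
  by rewrite addr_ge0// sqr_ge0.
- under [X in measurable_fun _ X]eq_fun do rewrite /= IE.
  by apply/measurable_EFinP; apply: measurable_funB; apply: measurable_funM.
- move=> x _; rewrite -EFinD lee_fin IE /ipart [leRHS]ger0_norm.
    rewrite !sqmodE -mulNr [in leRHS]addrC -[Re (f x) ^+ 2]sqrrN.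
    rewrite [_ ^+ 2 + Im (f x) ^+ 2]addrC [leRHS]addrC.
    exact: cross_term_le.
  by rewrite addr_ge0// sqr_ge0.
Qed.

Definition L2_dot (f g : L2) : R[i] :=
  (\int[mu]_x Re (f x * conjc (g x))) +i* (\int[mu]_x Im (f x * conjc (g x))).

Lemma ae_Rintegral (u v : X -> R) : measurable_fun setT u ->
  measurable_fun setT v -> (u = v %[ae mu]) ->
  \int[mu]_x u x = \int[mu]_x v x.
Proof.
move=> mu_ mv uv; rewrite /Rintegral; congr fine; apply: ae_eq_integral => //.
- exact/measurable_EFinP.
- exact/measurable_EFinP.
- by apply: filterS uv => x /= + _ => ->.
Qed.

Lemma L2_dotPl a (f g k : L2) : L2_dot (a *: f + g) k = a * L2_dot f k + L2_dot g k.
Proof.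
have [ir ii] := L2_mul_integrable f k; have [jr ji] := L2_mul_integrable g k.
have [kr ki] := L2_mul_integrable (a *: f + g) k.
have h1 := L2_scaleE a f; have h2 := L2_addE (a *: f) g.
have h3 : \forall x \ae mu, L2_fun (a *: f + g) x = a * f x + g x.
  by near=> x; rewrite (near h2 x)//= (near h1 x).
have mI (u : X -> R) : mu.-integrable setT (EFin \o u) ->
    measurable_fun setT u.
  by move=> ui; apply/measurable_EFinP; exact: measurable_int ui.
have iZ (c : R) (u : X -> R) : mu.-integrable setT (EFin \o u) ->
    mu.-integrable setT (EFin \o (fun x => c * u x)).
  by move=> ui; exact: (integrableZl measurableT c ui).
case: a h1 h2 h3 kr ki => a b h1 h2 h3 kr ki.
rewrite /L2_dot -[LHS]/(_ +i* _) -[RHS]/(_ +i* _); congr (_ +i* _).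
- rewrite (@ae_Rintegral _ (fun x => (a * Re (f x * conjc (k x)) -
      b * Im (f x * conjc (k x))) + Re (g x * conjc (k x)))).
  + rewrite RintegralD//; last first.
      exact: (integrableB measurableT (iZ a _ ir) (iZ b _ ii)).
    rewrite RintegralB//; last 2 first.
    * exact: iZ.
    * exact: iZ.
    by rewrite !RintegralZl.
  + exact: mI.
  + apply: measurable_funD; last exact: mI.
    by apply: measurable_funB; apply: measurable_funM => //; exact: mI.
  + apply: filterS h3 => x h3 _; rewrite h3.
    by case: (f x) => ? ?; case: (g x) => ? ?; case: (k x) => ? ? /=; ring.
- rewrite (@ae_Rintegral _ (fun x => (a * Im (f x * conjc (k x)) +
      b * Re (f x * conjc (k x))) + Im (g x * conjc (k x)))).
  + rewrite RintegralD//; last first.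
      exact: (integrableD measurableT (iZ a _ ii) (iZ b _ ir)).
    rewrite RintegralD//; last 2 first.
    * exact: iZ.
    * exact: iZ.
    by rewrite !RintegralZl.
  + exact: mI.
  + apply: measurable_funD; last exact: mI.
    by apply: measurable_funD; apply: measurable_funM => //; exact: mI.
  + apply: filterS h3 => x h3 _; rewrite h3.
    by case: (f x) => ? ?; case: (g x) => ? ?; case: (k x) => ? ? /=; ring.
Unshelve. all: by end_near. Qed.

Lemma L2_dot0l (f : L2) : L2_dot 0 f = 0.
Proof.
have := L2_dotPl 1 0 0 f; rewrite scaler0 addr0 mul1r => /eqP.
by rewrite -subr_eq0 opprD addrA subrr sub0r oppr_eq0 => /eqP.
Qed.

Lemma L2_dotC (f g : L2) : L2_dot g f = conjc (L2_dot f g).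
Proof.
have [_ ii] := L2_mul_integrable f g.
rewrite /L2_dot /=; congr (_ +i* _).
- apply: eq_Rintegral => x _.
  by case: (f x) => ? ?; case: (g x) => ? ? /=; ring.
- rewrite -mulN1r -RintegralZl//; apply: eq_Rintegral => x _.
  by case: (f x) => ? ?; case: (g x) => ? ? /=; ring.
Qed.

Lemma L2_dotE (f : L2) : L2_dot f f = (\int[mu]_x sqmod (f x))%:C.
Proof.
rewrite /L2_dot; congr (_ +i* _).
- apply: eq_Rintegral => x _; rewrite sqmodE.
  by case: (f x) => ? ? /=; ring.
- rewrite (@eq_Rintegral _ _ _ _ _ (cst 0)); last first.
    by move=> x _; case: (f x) => ? ? /=; ring.
  by rewrite /Rintegral integral0.
Qed.

Let q (f : L2) := Re (L2_dot f f).

Lemma L2_q_ge0 (f : L2) : 0 <= q f.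
Proof.
by rewrite /q L2_dotE/=; apply: fine_ge0; apply: integral_ge0 => x _;
  rewrite lee_fin sqr_ge0.
Qed.

Lemma L2_q_eq0 (f : L2) : q f = 0 -> f = 0.
Proof.
rewrite /q L2_dotE/= => f0; apply/L2_eqP.
have /square_integrableE[mf fi] := L2P f.
have i0 : (\int[mu]_x `|(EFin \o (fun x => sqmod (f x))) x| = 0)%E.
  rewrite (_ : (fun _ => _) = EFin \o (fun x => sqmod (f x))).
    by rewrite -[LHS]fineK ?integrable_fin_num// -/(Rintegral _ _ _) f0.
  by apply/funext => x /=; rewrite ger0_norm// sqr_ge0.
have := (ae_eq_integral_abs mu measurableT (measurable_sqmod mf)).1 i0.
have h0 : L2_fun 0 = (fun=> 0) %[ae mu].
  by move: (L2_addE 0 0); rewrite addr0; apply: filterS => x /= + _ => /(_ I) /eqP;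
     rewrite -subr_eq0 opprD addrA subrr sub0r oppr_eq0 => /eqP.
move: h0; apply: filterS2 => x /= -> // + _ => /(_ I) [] /eqP.
by rewrite /sqmod sqrf_eq0 => /eqP/eq0_normc.
Qed.

Lemma L2_qP (t : R) (f g : L2) :
  q (t%:C *: f + g) = t ^+ 2 * q f + 2 * t * Re (L2_dot f g) + q g.
Proof.
rewrite /q L2_dotPl (L2_dotC _ f) (L2_dotC _ g) !L2_dotPl (L2_dotC f g).
by case: (L2_dot f f) (L2_dot f g) (L2_dot g g) => ? ? [? ?] [? ?] /=; ring.
Qed.

Lemma L2_CauchySchwarz (f g : L2) :
  Re (L2_dot f g) <= Num.sqrt (q f) * Num.sqrt (q g).
Proof.
have qf := L2_q_ge0 f; have qg := L2_q_ge0 g.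
have [q0|qn0] := eqVneq (q f) 0.
  have f0 := L2_q_eq0 q0.
  by rewrite f0 L2_dot0l mulr_ge0 ?sqrtr_ge0.
have qp : 0 < q f by rewrite lt_def qn0.
rewrite -sqrtrM//; apply: le_trans (ler_norm _) _.
rewrite -sqrtr_sqr ler_sqrt ?mulr_ge0//.
have := L2_q_ge0 ((- (Re (L2_dot f g) / q f))%:C *: f + g).
rewrite L2_qP; set r := Re _.
have -> : (- (r / q f)) ^+ 2 * q f + 2 * (- (r / q f)) * r + q g =
  q g - r ^+ 2 / q f by field.
by rewrite subr_ge0 ler_pdivrMr// mulrC.
Qed.

Definition L2_norm (f : L2) : R[i] := (Num.sqrt (q f))%:C.

Lemma L2_normD (f g : L2) : L2_norm (f + g) <= L2_norm f + L2_norm g.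
Proof.
rewrite /L2_norm -rmorphD lecR.
have s0 (k : L2) : 0 <= Num.sqrt (q k) by exact: sqrtr_ge0.
rewrite -[leRHS]ger0_norm ?addr_ge0// -sqrtr_sqr.
rewrite ler_sqrt ?sqr_ge0// -[f]scale1r (L2_qP 1) scale1r sqrrD !sqr_sqrtr ?L2_q_ge0//.
have := L2_CauchySchwarz f g; lra.
Qed.

Lemma L2_normZ (a : R[i]) (f : L2) : L2_norm (a *: f) = `|a| * L2_norm f.
Proof.
rewrite /L2_norm normc_def -rmorphM -sqrtrM ?addr_ge0 ?sqr_ge0//.
congr ((Num.sqrt _)%:C).
have Z (b : R[i]) (g k : L2) : L2_dot (b *: g) k = b * L2_dot g k.
  have := L2_dotPl b g (0 : L2) k.
  by rewrite L2_dot0l !addr0.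
rewrite /q Z L2_dotC Z L2_dotE; case: a => a b /=; ring.
Qed.

Lemma L2_norm0_eq0 (f : L2) : L2_norm f = 0 -> f = 0.
Proof.
move=> /complexI/eqP; rewrite sqrtr_eq0 => q0; apply: L2_q_eq0.
by apply/eqP; rewrite eq_le q0 L2_q_ge0.
Qed.

HB.instance Definition _ :=
  Lmodule_isNormed.Build R[i] L2 L2_normD L2_normZ L2_norm0_eq0.

Lemma L2_dot_norm (f : L2) : L2_dot f f = `|f| ^+ 2.
Proof.
have -> : `|f| = (Num.sqrt (q f))%:C by [].
by rewrite -rmorphXn/= sqr_sqrtr ?L2_q_ge0// /q L2_dotE.
Qed.

HB.instance Definition _ := NormedModule_isInnerProduct.Build R L2
  L2_dotPl L2_dotC L2_dot_norm.

End square_integrable.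

Coercion L2_fun : L2 >-> Funclass.

Section weighted_measure.
Context d (X : measurableType d) (R : realType).
Variables (mu : {measure set X -> \bar R}) (w : X -> R[i]).
Hypothesis mw : cmeasurable w.
Local Open Scope ereal_scope.

Definition weighted_measure of cmeasurable w := fun A : set X =>
  \int[mu]_(x in A) (sqmod (w x))%:E.

Local Notation mu_w := (weighted_measure mw).

Let mu_w0 : mu_w set0 = 0.
Proof. exact: integral_set0. Qed.

Let mu_w_ge0 A : 0 <= mu_w A.
Proof. by apply: integral_ge0 => x _; rewrite lee_fin sqr_ge0. Qed.

Let mu_w_sigma_additive : semi_sigma_additive mu_w.
Proof.
move=> F mF tF mUF; rewrite /weighted_measure ge0_integral_bigcup//.
- apply: is_cvg_ereal_nneg_natsum_cond => n _ _.
  exact: mu_w_ge0.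
- by apply: measurable_funTS; exact: measurable_sqmod.
- by move=> x _; rewrite lee_fin sqr_ge0.
Qed.

HB.instance Definition _ := isMeasure.Build _ _ _
  mu_w mu_w0 mu_w_ge0 mu_w_sigma_additive.

End weighted_measure.

Section weighted_composition.
Context d (X : measurableType d) (R : realType).
Implicit Types (mu nu : {measure set X -> \bar R}) (phi : X -> X).
Implicit Types (w : X -> R[i]) (h f e g rho : X -> \bar R).

Definition L2_weight mu rho : set (L2 mu) :=
  [set f : L2 mu | (\int[mu]_x ((sqmod (f x))%:E * rho x) < +oo)%E].

(* The choice of the representative of p.1 is immaterial as soon as the image
   under phi of the measure |w|^2 dmu is absolutely continuous with respect to
   mu. *)
Definition wcomp mu w phi : set (L2 mu * L2 mu) :=
  [set p : L2 mu * L2 mu |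
    L2_fun p.2 = (fun x => w x * L2_fun p.1 (phi x)) %[ae mu]].

Definition is_radon_nikodym mu (nu : set X -> \bar R) h :=
  [/\ measurable_fun setT h, forall x, (0 <= h x)%E &
      forall A, measurable A -> nu A = (\int[mu]_(x in A) h x)%E].

(* e is a version of the conditional expectation of f >= 0 with respect to the
   sigma-algebra of preimages phi^-1(A), A measurable, and the measure nu. *)
Definition is_cond_exp nu phi f e :=
  [/\ forall B, measurable B ->
        preimage_set_system setT phi measurable (e @^-1` B),
      forall x, (0 <= e x)%E &
      forall A, measurable A ->
        (\int[nu]_(x in phi @^-1` A) e x = \int[nu]_(x in phi @^-1` A) f x)%E].

(* g is a version of "e o phi^-1", normalized to vanish off {h > 0}. *)
Definition is_comp_inv mu nu phi h e g :=
  [/\ measurable_fun setT g, forall x, (0 <= g x)%E,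
      e = (g \o phi) %[ae nu] &
      g = (fun x => g x * (\1_[set x | (0 < h x)%E] x)%:E)%E %[ae mu]].

End weighted_composition.

Arguments L2_weight {d X R} mu rho _.
Arguments wcomp {d X R} mu w phi _.

(* Main.v *)
(** Write p for h (finite almost everywhere, C being densely defined). Testing
    against indicator-truncated functions shows that C*C is the multiplication
    by p. Powers of a positive operator are given by an arbitrary spectral
    measure E, so one has to know that a multiplication operator M_p has only
    one: the range of E(]-oo, t]) is invariant under M_p, and a moment argument
    shows that its elements are supported in {p <= t}; conversely, a function
    supported in {p <= t} and orthogonal to that range would satisfy both
    <M_p f, f> <= t |f|^2 and the opposite strict inequality. Hence |C|^s is the
    multiplication by p^(s/2), and the phase of C is the weighted composition
    operator with weight w / sqrt (p o phi). The Aluthge transform is therefore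
    the restriction of C_{phi,walpha} to the domain of p^((1 - alpha)/2). The
    truncations 1_{p <= n} f show that this domain is a core, and equality of
    the two operators is the inclusion of one weighted L2 space in another,
    which amounts to the stated pointwise bound between the weights. *)
Require Import Defs.
From HB Require Import structures.
From mathcomp Require Import all_boot all_order all_algebra.
From mathcomp Require Import all_classical all_reals all_analysis.
From mathcomp Require Import measurable_realfun complex ring lra.
Import Order.TTheory GRing.Theory Num.Theory.
Import numFieldNormedType.Exports.
Local Open Scope classical_set_scope.
Local Open Scope complex_scope.
Local Open Scope ring_scope.

Set Implicit Arguments.
Unset Strict Implicit.
Unset Printing Implicit Defensive.

Local Notation Re := complex.Re.
Local Notation Im := complex.Im.

(** * Integration with respect to the image of a measure with a density *)

(** Powers and phases are selected by [get], so nothing is known of them until both existence and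
    uniqueness are settled; most of the work goes there. A spectral measure is accessible only
    through its scalar measures [m x]: each relation between two projections is extracted from
    monotonicity and additivity of [m x], together with symmetry and idempotence of each projection.
    The preimage under phi of a null set need not be null. Identities transported by phi therefore
    hold only where the weight is nonzero, which is enough because the weight multiplies them. There
    p o phi is positive as well, and with the conventions 0^-1 = 0 and 0^r = 0 for nonzero r,
    formulas with negative powers of p make sense everywhere. While h may be replaced by a finite p,
    the density attached to walpha may be infinite on a set of positive measure. Hence closedness of
    C_{phi,walpha} is shown by truncation rather than by a description of its adjoint, and the
    comparison of weights allows one of them to take the value [+oo]. *)

Section image_density.
Context d d' (X : measurableType d) (Y : measurableType d') (R : realType).
Variables (mu : {measure set X -> \bar R}) (nu : {measure set Y -> \bar R}).
Variables (phi : X -> Y) (k : X -> \bar R).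
Hypotheses (mphi : measurable_fun setT phi) (mk : measurable_fun setT k).
Hypothesis k0 : forall x, (0 <= k x)%E.
Hypothesis nuE : forall D, measurable D ->
  nu D = (\int[mu]_(x in phi @^-1` D) k x)%E.
Local Open Scope ereal_scope.
Import HBNNSimple.

Lemma ge0_integral_image_density (f : Y -> \bar R) :
  measurable_fun setT f -> (forall y, 0 <= f y) ->
  \int[nu]_y f y = \int[mu]_x (f (phi x) * k x).
Proof.
move=> mf f0; pose s := nnsfun_approx measurableT mf.
have s_cvg y : (s n y)%:E @[n --> \oo] --> f y.
  by apply: cvg_nnsfun_approx.
have s_nd y m n : (m <= n)%N -> (s m y)%:E <= (s n y)%:E.
  by move=> mn; rewrite lee_fin; exact/lefP/nd_nnsfun_approx.
have ms n : measurable_fun setT (fun x => (s n (phi x))%:E).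
  apply/measurable_EFinP; apply: measurableT_comp => //; exact: measurable_funP.
have -> : \int[nu]_y f y = limn (fun n => \int[nu]_y (s n y)%:E).
  rewrite -monotone_convergence//.
  - by apply: eq_integral => y _; apply/esym/cvg_lim => //.
  - by move=> n; apply/measurable_EFinP/measurable_funP.
  - by move=> n y _; rewrite lee_fin.
  - by move=> y _ m n; exact: s_nd.
have -> : \int[mu]_x (f (phi x) * k x) =
    limn (fun n => \int[mu]_x ((s n (phi x))%:E * k x)).
  rewrite -monotone_convergence//.
  - apply: eq_integral => x _; apply/esym/cvg_lim => //.
    (* Multiplication by [k x = +oo] is not continuous at 0. If [f (phi x) = 0], all the
       approximations vanish there; otherwise they are eventually positive and the products are
       eventually [+oo]. *)
    have [kfin|] := boolP (k x \is a fin_num); first exact: cvgeZr.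
    rewrite ge0_fin_numE// -leNgt leye_eq => /eqP ->.
    have [f0'|fn0] := eqVneq (f (phi x)) 0.
      have s0 n : (s n (phi x))%:E = 0.
        apply/eqP; rewrite eq_le; apply/andP; split; last by rewrite lee_fin.
        rewrite -f0'.
        have snd : {homo (fun n => (s n (phi x))%:E) : m j / (m <= j)%N >-> m <= j}.
          by move=> m j; exact: s_nd.
        rewrite (cvg_unique _ (s_cvg (phi x)) (ereal_nondecreasing_cvgn snd))//.
        by apply: ereal_sup_ubound; exists n.
      under eq_fun do rewrite s0.
      by rewrite f0' mul0e; exact: cvg_cst.
    have fp : 0 < f (phi x) by rewrite lt_def fn0 f0.
    rewrite gt0_muley//; apply: cvg_near_cst.
    have : \forall n \near \oo, 0 < (s n (phi x))%:E.
      exact: (s_cvg (phi x)) _ (open_ereal_gt' fp).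
    by apply: filterS => n sn; rewrite gt0_muley.
  - by move=> n; apply: emeasurable_funM.
  - by move=> n x _; rewrite mule_ge0// lee_fin.
  - by move=> x _ m n mn; rewrite lee_wpmul2r// s_nd.
apply/congr_lim/funext => n.
under eq_integral do rewrite fimfunE -fsumEFin//.
rewrite ge0_integral_fsum//; last 2 first.
- by move=> r; apply/measurable_EFinP; exact: measurable_funM.
- by move=> r y _; exact: nnfun_muleindic_ge0.
transitivity (\int[mu]_x (\sum_(r \in range (s n))
    (r * \1_(s n @^-1` [set r]) (phi x))%:E * k x)); last first.
  apply: eq_integral => x _.
  rewrite -ge0_mule_fsuml => [|y]; last exact: nnfun_muleindic_ge0.
  by rewrite fsumEFin // -(fimfunE _ (phi x)).
have mi r : measurable_fun setT (fun x => \1_(s n @^-1` [set r]) (phi x) : R).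
  by apply: measurableT_comp.
rewrite ge0_integral_fsum//; last 2 first.
- move=> r; apply: emeasurable_funM => //; apply/measurable_EFinP.
  by apply: measurable_funM.
- by move=> r y _; rewrite mule_ge0// nnfun_muleindic_ge0.
apply: eq_fsbigr => r rs.
have mr : measurable (s n @^-1` [set r]) by [].
under eq_integral do rewrite EFinM.
rewrite integralZl_indic_nnsfun// integral_indic// setIT nuE//.
under [RHS]eq_integral do rewrite EFinM -muleA.
rewrite ge0_integralZl//; last 3 first.
- by apply: emeasurable_funM => //; exact/measurable_EFinP.
- by move=> x _; rewrite mule_ge0// lee_fin.
- by move: rs; rewrite inE => -[y _ <-]; rewrite lee_fin.
congr (_ * _).
rewrite integral_mkcond; apply: eq_integral => x _.
by rewrite epatch_indic/= muleC.
Qed.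

Lemma ge0_integral_image_density_set (f : Y -> \bar R) (D : set Y) :
  measurable D -> measurable_fun setT f -> (forall y, 0 <= f y) ->
  \int[nu]_(y in D) f y = \int[mu]_(x in phi @^-1` D) (f (phi x) * k x).
Proof.
move=> mD mf f0; rewrite integral_mkcond [RHS]integral_mkcond.
rewrite (ge0_integral_image_density (f := f \_ D)).
- apply: eq_integral => x _; rewrite !epatch_indic/= muleAC.
  by rewrite !indicE.
- by apply/(measurable_restrict _ mD measurableT); rewrite setTI; exact: measurable_funTS.
- by move=> y; rewrite patchE; case: ifP.
Qed.

End image_density.

Section integral_image_density.
Context d d' (X : measurableType d) (Y : measurableType d') (R : realType).
Variables (mu : {measure set X -> \bar R}) (nu : {measure set Y -> \bar R}).
Variables (phi : X -> Y) (k : X -> R).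
Hypotheses (mphi : measurable_fun setT phi) (mk : measurable_fun setT k).
Hypothesis k0 : forall x, 0 <= k x.
Hypothesis nuE : forall D, measurable D ->
  nu D = (\int[mu]_(x in phi @^-1` D) (k x)%:E)%E.
Local Open Scope ereal_scope.

Lemma integral_image_density (f : Y -> \bar R) : measurable_fun setT f ->
  \int[nu]_y f y = \int[mu]_x (f (phi x) * (k x)%:E).
Proof.
move=> mf; have mEk : measurable_fun setT (fun x => (k x)%:E).
  exact/measurable_EFinP.
have kE x : 0 <= (k x)%:E by rewrite lee_fin.
rewrite integralE [RHS]integralE; congr (_ - _).
- rewrite (ge0_integral_image_density mphi mEk kE nuE)//.
    by apply: eq_integral => x _; rewrite !funeposE maxe_pMl// mul0e.
  exact: measurable_funepos.
- rewrite (ge0_integral_image_density mphi mEk kE nuE)//.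
    by apply: eq_integral => x _; rewrite !funenegE maxe_pMl// mul0e mulNe.
  exact: measurable_funeneg.
Qed.

End integral_image_density.

(** * Inner product spaces *)

Section hilbert.
Context (R : realType) (H : innerProdType R).
Implicit Types x y z : H.

(** The norm takes its values in [R[i]]; estimates are made on this real-valued square of it. *)
Definition nrm2 x : R := Re (dot x x).

Lemma dotDl x y z : dot (x + y) z = dot x z + dot y z.
Proof. by have := dotPl 1 x y z; rewrite scale1r mul1r. Qed.

Lemma dot0l x : dot 0 x = 0.
Proof. by apply: (addrI (dot 0 x)); rewrite -dotDl !addr0. Qed.

Lemma dotZl a x y : dot (a *: x) y = a * dot x y.
Proof. by have := dotPl a x 0 y; rewrite addr0 dot0l addr0. Qed.

Lemma dotNl x y : dot (- x) y = - dot x y.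
Proof. by rewrite -scaleN1r dotZl mulN1r. Qed.

Lemma dotBl x y z : dot (x - y) z = dot x z - dot y z.
Proof. by rewrite dotDl dotNl. Qed.

Lemma dotDr x y z : dot x (y + z) = dot x y + dot x z.
Proof. by rewrite dotC dotDl rmorphD/= -!dotC. Qed.

Lemma dotZr a x y : dot x (a *: y) = conjc a * dot x y.
Proof. by rewrite dotC dotZl rmorphM/= -dotC. Qed.

Lemma dotNr x y : dot x (- y) = - dot x y.
Proof. by rewrite dotC dotNl rmorphN/= -dotC. Qed.

Lemma dotBr x y z : dot x (y - z) = dot x y - dot x z.
Proof. by rewrite dotDr dotNr. Qed.

Lemma dot0r x : dot x 0 = 0.
Proof. by rewrite dotC dot0l conjc0. Qed.

Lemma norm_nrm2 x : `|x| = (Num.sqrt (nrm2 x))%:C.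
Proof.
rewrite /nrm2 dot_norm; have := normr_ge0 x.
case: `|x| => a b; rewrite lecE => /andP[/eqP/= -> a0].
by rewrite mul0r subr0 -expr2 sqrtr_sqr ger0_norm.
Qed.

Lemma nrm2_ge0 x : 0 <= nrm2 x.
Proof.
rewrite /nrm2 dot_norm norm_nrm2 -rmorphXn; exact: sqr_ge0.
Qed.

Lemma nrm2_eq0 x : nrm2 x = 0 -> x = 0.
Proof.
by move=> x0; apply/eqP; rewrite -normr_eq0 norm_nrm2 x0 sqrtr0.
Qed.

Lemma nrm20 : nrm2 0 = 0 :> R.
Proof. by rewrite /nrm2 dot0l. Qed.

Lemma nrm2N x : nrm2 (- x) = nrm2 x.
Proof. by rewrite /nrm2 dotNl dotNr opprK. Qed.

Lemma nrm2D x y : nrm2 (x + y) = nrm2 x + nrm2 y + 2 * Re (dot x y).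
Proof.
rewrite /nrm2 dotDl !dotDr (dotC x y).
case: (dot x x) (dot x y) (dot y y) => a b [c e] [k l] /=; ring.
Qed.

Lemma nrm2D_le x y : nrm2 (x + y) <= 2 * nrm2 x + 2 * nrm2 y.
Proof.
have := nrm2_ge0 (x - y); rewrite !nrm2D nrm2N dotNr raddfN/= => h.
by lra.
Qed.

Lemma nrm2B x y : nrm2 (x - y) = nrm2 (y - x).
Proof. by rewrite -nrm2N opprB. Qed.

Lemma nbhs_nrm2P x (A : set H) : nbhs x A <->
  exists2 r : R, 0 < r & forall y, nrm2 (x - y) < r -> A y.
Proof.
split.
  move=> /nbhs_ballP[e /=]; rewrite ltcE/= => /andP[/eqP Ie e0] eA.
  exists (Re e ^+ 2); first by rewrite exprn_gt0.
  move=> y xy; apply: eA; rewrite -ball_normE/= norm_nrm2 ltcE/= Ie eqxx/=.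
  rewrite -(ger0_norm (ltW e0)) -sqrtr_sqr ltr_sqrt//.
  by rewrite exprn_gt0.
move=> [r r0 rA]; apply/nbhs_ballP; exists (Num.sqrt r)%:C => /=.
  by rewrite ltcR sqrtr_gt0.
move=> y; rewrite -ball_normE/= norm_nrm2 ltcR ltr_sqrt//.
exact: rA.
Qed.

Lemma closure_graphP (A : set (H * H)) x y : closure A (x, y) <->
  forall r : R, 0 < r -> exists x' y',
    [/\ A (x', y'), nrm2 (x - x') < r & nrm2 (y - y') < r].
Proof.
split=> [cA r r0|rA B].
  have [|[x' y'] [Axy [/= x'r y'r]]] := cA
      ([set x' | nrm2 (x - x') < r] `*` [set y' | nrm2 (y - y') < r]).
    exists ([set x' | nrm2 (x - x') < r], [set y' | nrm2 (y - y') < r]) => //.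
    by split; apply/nbhs_nrm2P; exists r.
  by exists x', y'.
move=> [[B1 B2] [/= /nbhs_nrm2P[r1 r10 rB1] /nbhs_nrm2P[r2 r20 rB2]] B12].
have r0 : 0 < Num.min r1 r2 by rewrite lt_min r10.
have [x' [y' [Axy + +]]] := rA _ r0.
rewrite !lt_min => /andP[x1 _] /andP[_ y2].
exists (x', y'); split => //; apply: B12; split => /=; [exact: rB1|exact: rB2].
Qed.

(** Expanding the form at a x + y gives a <Tx, y> + conj(a) <Ty, x> = 0. For a = 1 the two products
    are opposite, for a = i they are equal. *)
Lemma polarization_eq0 (D : set H) (T : H -> H) :
  (forall a x y, D x -> D y -> D (a *: x + y)) ->
  (forall a x y, D x -> D y -> T (a *: x + y) = a *: T x + T y) ->
  (forall x, D x -> dot (T x) x = 0) ->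
  forall x y, D x -> D y -> dot (T x) y = 0.
Proof.
move=> DD TD T0 x y Dx Dy.
have cross a : a * dot (T x) y + conjc a * dot (T y) x = 0.
  have := T0 _ (DD a _ _ Dx Dy).
  by rewrite TD// dotDl !dotZl !dotDr !dotZr !T0// !mulr0 addr0 add0r.
have h1 := cross 1; have hi := cross 'i%C.
rewrite mul1r conjc1 mul1r in h1; move: hi.
have -> : dot (T y) x = - dot (T x) y.
  by apply/eqP; rewrite -addr_eq0 addrC h1.
case: (dot (T x) y) => a b [] /=.
rewrite !(mul0r, mul1r, sub0r, addr0, mulrN, mulN1r, opprK, add0r, subr0).
move=> hb ha; congr (_ +i* _); lra.
Qed.

End hilbert.

(** * Spectral measures *)

Section spectral.
Context (R : realType) (H : innerProdType R).
Local Notation RR := (measurableTypeR R).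
Variables (E : set RR -> H -> H) (m : H -> {measure set RR -> \bar R}).
Hypothesis Em : spectral_measure E m.
Implicit Types (x y z : H) (D B : set RR).

Lemma spectral_linear D : measurable D -> linear (E D).
Proof. by case: Em => + _ _ => /[apply] -[]. Qed.

Lemma spectral_idem D x : measurable D -> E D (E D x) = E D x.
Proof. by case: Em => + _ _ => /[apply] -[]. Qed.

Lemma spectral_sym D x y : measurable D -> dot (E D x) y = dot x (E D y).
Proof. by case: Em => + _ _ => /[apply] -[]. Qed.

Lemma spectralD D x y : measurable D -> E D (x + y) = E D x + E D y.
Proof. by move=> /spectral_linear/(_ 1 x y); rewrite !scale1r. Qed.

Lemma spectral0 D : measurable D -> E D 0 = 0.
Proof.
by move=> mD; apply: (addrI (E D 0)); rewrite -spectralD// !addr0.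
Qed.

Lemma spectralN D x : measurable D -> E D (- x) = - E D x.
Proof.
by move=> mD; apply: (addrI (E D x)); rewrite -spectralD// !subrr spectral0.
Qed.

Lemma spectralB D x y : measurable D -> E D (x - y) = E D x - E D y.
Proof. by move=> mD; rewrite spectralD// spectralN. Qed.

Lemma spectral_nrm2 D x : measurable D -> m x D = (nrm2 (E D x))%:E.
Proof.
move=> mD; case: Em => _ _ -> //.
by rewrite /nrm2 [in RHS]spectral_sym// spectral_idem// -spectral_sym.
Qed.

Lemma spectral_nrm2_split D x : measurable D ->
  nrm2 x = nrm2 (E D x) + nrm2 (x - E D x).
Proof.
move=> mD; have := nrm2D (E D x) (x - E D x); rewrite addrC subrK => ->; rewrite dotBr.
rewrite [dot (E D x) (E D x)]spectral_sym// spectral_idem// -spectral_sym//.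
by rewrite subrr mulr0 addr0.
Qed.

(** Only the projection of [0, +oo[ is given as the identity. Monotonicity of [m x] squeezes |E setT
    x|^2 between |x|^2, its mass on [0, +oo[, and |x|^2, the bound for any projection. *)
Lemma spectral_setT x : m x setT = (nrm2 x)%:E.
Proof.
rewrite spectral_nrm2//; congr EFin; apply/eqP; rewrite eq_le.
rewrite {1}(spectral_nrm2_split x measurableT) lerDl nrm2_ge0/=.
have mI : measurable (`[0, +oo[%classic : set RR) by exact: measurable_itv.
rewrite -lee_fin -spectral_nrm2//; case: Em => _ EI _.
rewrite -[in leLHS](EI x) -spectral_nrm2//.
by apply: le_measure; rewrite ?inE.
Qed.

Lemma spectral_eq0 D x : measurable D -> E D x = 0 <-> m x D = 0%E.
Proof.
move=> mD; rewrite spectral_nrm2//; split=> [->|[]]; first by rewrite nrm20.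
exact: nrm2_eq0.
Qed.

(** Comparing the Pythagorean splitting of x with additivity of [m x] identifies the mass of the
    complement of [D] with |x - E D x|^2. *)
Lemma spectral_id D x : measurable D -> E D x = x <-> m x (~` D) = 0%E.
Proof.
move=> mD; have mDC := measurableC mD.
have := spectral_nrm2_split x mD => xs.
have : (nrm2 x)%:E = (m x D + m x (~` D))%E.
  by rewrite -spectral_setT -measureU ?setUv// setICr.
rewrite (spectral_nrm2 x mD) (spectral_nrm2 x mDC) -EFinD => -[].
rewrite xs => /addrI <-; split=> [->|[] /nrm2_eq0/eqP].
  by rewrite subrr nrm20.
by rewrite subr_eq0 => /eqP.
Qed.

(* If x is carried by D and y by its complement, then m x vanishes on the Borel
   subsets of ~` D, so E B x = 0 there by monotonicity of m x alone, and
   symmetrically for y; additivity of E in the set is never needed. *)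
Lemma spectral_measureD D x y B : measurable D -> measurable B ->
  E D x = x -> E D y = 0 -> m (x + y) B = (m x B + m y B)%E.
Proof.
move=> mD mB /spectral_id-/(_ mD) xD /spectral_eq0-/(_ mD) yD.
have mB1 : measurable (B `&` D) by exact: measurableI.
have mB2 : measurable (B `&` ~` D).
  by apply: measurableI => //; exact: measurableC.
have BE z : m z B = (m z (B `&` D) + m z (B `&` ~` D))%E.
  rewrite -measureU// -?setIUr ?setUv ?setIT//.
  by rewrite setIACA setICr setI0.
have y0 : E (B `&` D) y = 0.
  by apply/spectral_eq0 => //; apply: (subset_measure0 _ mD).
have x0 : E (B `&` ~` D) x = 0.
  apply/spectral_eq0 => //; apply: (subset_measure0 _ (measurableC mD)) => //.
rewrite !BE !spectral_nrm2// !spectralD// x0 y0 addr0 add0r nrm20.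
by rewrite adde0 add0e.
Qed.

Lemma spectral_lt0 x : m x `]-oo, 0[%classic = 0%E.
Proof.
have <- : ~` `[0, +oo[%classic = `]-oo, 0[%classic :> set R.
  exact: setCitvr.
apply/spectral_id; first exact: measurable_itv.
by case: Em => _ ->.
Qed.

(* m x is carried by the half-line t >= 0, so t may be replaced by |t|. *)
Let absm x : \bar R := (\int[m x]_t `|t|%:E)%E.

Lemma spectral_fin x : (m x setT < +oo)%E.
Proof. by rewrite spectral_setT ltry. Qed.

Lemma measurable_abs_fun : measurable_fun setT (fun t : RR => `|t|%:E).
Proof. by apply/measurable_EFinP; exact: normr_measurable. Qed.

Lemma spectral_ge0 x : {ae m x, forall t : RR, 0 <= (t : R)}.
Proof.
exists `]-oo, 0[%classic; split; [exact: measurable_itv|exact: spectral_lt0|].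
by move=> t /= /negP; rewrite -ltNge in_itv.
Qed.

Lemma spectral_absE x : (\int[m x]_t t%:E)%E = absm x.
Proof.
apply: ae_eq_integral => //.
- exact: measurable_abs_fun.
- by apply: filterS (spectral_ge0 x) => t t0 _ /=; rewrite ger0_norm.
Qed.

Lemma ge0_integral_spectralD D x y (f : RR -> \bar R) : measurable D ->
  (forall t, 0 <= f t)%E -> measurable_fun setT f ->
  E D x = x -> E D y = 0 ->
  (\int[m (x + y)%R]_t f t = \int[m x]_t f t + \int[m y]_t f t)%E.
Proof.
move=> mD f0 mf xD yD; rewrite -ge0_integral_measure_add//.
apply: eq_measure_integral => A mA _.
by rewrite (spectral_measureD mD mA)//; exact/esym/measure_addE.
Qed.

Lemma spectral_le x (f : RR -> \bar R) D (c : R) : measurable D ->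
  measurable_fun setT f -> (forall t, 0 <= f t)%E ->
  (0 <= c) -> E D x = x -> (forall t : R, D t -> 0 <= t -> (f t <= c%:E)%E) ->
  (\int[m x]_t f t <= (c * nrm2 x)%:E)%E.
Proof.
move=> mD mf f0 c0 xD fc; rewrite EFinM -spectral_setT -integral_cst//.
apply: ae_ge0_le_integral => //.
have : {ae m x, forall t : RR, D t}.
  exists (~` D); split => //; [exact: measurableC|exact/spectral_id].
by apply: filterS2 (spectral_ge0 x) => t t0 Dt _; exact: fc.
Qed.

Lemma spectral_abs_fin x : (\int[m x]_t (t ^+ 2)%:E < +oo)%E ->
  (absm x < +oo)%E.
Proof.
move=> x2; apply: (@le_lt_trans _ _ (\int[m x]_t (1 + (t ^+ 2)%:E))%E).
  apply: ge0_le_integral => //.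
  - exact: measurable_abs_fun.
  - apply: emeasurable_funD => //; apply/measurable_EFinP.
    by apply: measurable_funX; exact: measurable_id.
  - move=> t _; rewrite -EFinD lee_fin.
    have := sqr_ge0 (`|t| - 1); rewrite -[t ^+ 2]real_normK ?num_real//.
    by have := normr_ge0 t; nra.
rewrite ge0_integralD//.
- by rewrite lte_add_pinfty// integral_cst// mul1e spectral_fin.
- by move=> t _; rewrite lee_fin sqr_ge0.
- by apply/measurable_EFinP; apply: measurable_funX; exact: measurable_id.
Qed.

Section operator.
Variable P : set (H * H).
Hypothesis mP : spectral_integral m id P.

Lemma spectral_dom x x' : P (x, x') -> (absm x < +oo)%E.
Proof.
move=> Px; apply: spectral_abs_fin.
by case: mP => _ Pd _; have : opdom P x by [exists x']; rewrite Pd.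
Qed.

Lemma spectral_dot x x' : P (x, x') -> ((Re (dot x' x))%:E = absm x)%E.
Proof.
move=> Px; case: mP => _ _ /(_ _ _ Px) -> /=.
rewrite /Rintegral spectral_absE fineK// ge0_fin_numE.
  exact: spectral_dom Px.
by apply: integral_ge0.
Qed.

(** On [0, c] the integrand t^2 is at most c^2. This is the supply of vectors in the domain of [P]:
    a spectral cut-off always lands there. *)
Lemma spectral_bounded_dom D x (c : R) : measurable D -> 0 <= c ->
  (forall t, D t -> t <= c) -> E D x = x -> opdom P x.
Proof.
move=> mD c0 Dc xD; case: mP => _ -> _ /=.
apply: le_lt_trans (ltry (c ^+ 2 * nrm2 x)).
apply: (spectral_le mD) => //.
- by apply/measurable_EFinP; apply: measurable_funX; exact: measurable_id.
- by move=> t; rewrite lee_fin sqr_ge0.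
- exact: sqr_ge0.
- by move=> t Dt t0; rewrite lee_fin lerXn2r// ?nnegrE// Dc.
Qed.

Hypothesis symP : forall x x' y y',
  P (x, x') -> P (y, y') -> dot x' y = dot x y'.

(** The scalar measures of x and y add up to that of x + y, hence so do the quadratic forms of [P],
    and the cross term 2 Re <Px, y> has to vanish. *)
Lemma spectral_orth D x x' y y' : measurable D -> E D x = x -> E D y = 0 ->
  P (x, x') -> P (y, y') -> Re (dot x' y) = 0.
Proof.
move=> mD xD yD Px Py.
have Pxy : P (x + y, x' + y').
  by case: mP => -[_ _ /(_ 1 _ _ Px Py)] + _ _; rewrite !scale1r.
have := spectral_dot Pxy; rewrite {1}/absm (ge0_integral_spectralD mD)//; last first.
  exact: measurable_abs_fun.
rewrite -[(\int[m x]_t _)%E](spectral_dot Px).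
rewrite -[(\int[m y]_t _)%E](spectral_dot Py) -EFinD => -[].
rewrite dotDl !dotDr (dotC x y') -(symP Px Py).
by case: (dot x' x) (dot x' y) (dot y' y) => ? ? [? ?] [? ?] /=; lra.
Qed.

(* z := Px - E(]-oo, t]) Px is tested against the vectors E(]t, n]) z, which
   belong to the domain of P, unlike z. *)
Lemma spectral_invariant (t : R) x x' : P (x, x') ->
  E `]-oo, t]%classic x = x -> E `]-oo, t]%classic x' = x'.
Proof.
move=> Px xt; set D : set RR := `]-oo, t]%classic.
have mD : measurable D by exact: measurable_itv.
pose z := x' - E D x'.
have zD : E D z = 0 by rewrite /z spectralB// spectral_idem// subrr.
suff z0 : z = 0 by apply/esym/eqP; rewrite -subr_eq0 -/z z0.
have zN (n : nat) : m z `]t, n%:R]%classic = 0%E.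
  set B : set RR := `]t, n%:R]%classic.
  have mB : measurable B by exact: measurable_itv.
  have BE : E B (E B z) = E B z by exact: spectral_idem.
  have DE : E D (E B z) = 0.
    apply/spectral_eq0 => //; have /spectral_id-/(_ mB) := BE.
    apply: subset_measure0 => //; first exact: measurableC.
    move=> s; rewrite /D /B /= !in_itv/= => st; apply/negP.
    by rewrite negb_and -leNgt st.
  have [y' Py] : opdom P (E B z).
    apply: (spectral_bounded_dom mB (ler0n R n)) => //.
    by move=> s; rewrite /B /= in_itv/= => /andP[].
  (* As [E D (E B z) = 0], the component [E D x'] is orthogonal to [E B z]; what remains of the
     product is <z, E B z> = |E B z|^2. *)
  have := spectral_orth mD xt DE Px Py.
  rewrite -[x'](subrK (E D x')) -/z dotDl (spectral_sym _ _ mD) DE dot0r addr0.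
  by rewrite -BE -spectral_sym// spectral_nrm2// => zz; congr EFin.
have : m z (~` D) = 0%E.
  have -> : ~` D = \bigcup_n `]t, n%:R]%classic.
    rewrite /D setCitvl; apply/seteqP; split=> s /=.
      rewrite in_itv/= andbT => ts; exists (Num.trunc s).+1 => //=.
      by rewrite in_itv/= ts ltW// truncnS_gt.
    by move=> [n _] /=; rewrite !in_itv/= => /andP[->].
  apply/negligibleP; first by apply: bigcup_measurable => n _; exact: measurable_itv.
  apply: negligible_bigcup => n; apply/negligibleP; first exact: measurable_itv.
  exact: zN.
by move=> /spectral_id-/(_ mD) <-.
Qed.

(* m x lives on ]t, +oo[, where s > t strictly, so <Px, x> > t |x|^2 unless
   m x = 0. *)
Lemma spectral_gt (t : R) x x' : 0 <= t -> P (x, x') ->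
  E `]-oo, t]%classic x = 0 -> Re (dot x' x) <= t * nrm2 x -> x = 0.
Proof.
move=> t0 Px; set D : set RR := `]-oo, t]%classic => xD xt.
have mD : measurable D by exact: measurable_itv.
have xD0 : m x D = 0%E by exact/spectral_eq0.
have aet : {ae m x, forall s : RR, t < (s : R)}.
  exists D; split => //.
  by move=> s /= /negP; rewrite -leNgt /D /= in_itv.
apply: nrm2_eq0; apply/eqP; rewrite -eqe -spectral_setT.
(* The excess of |s| over t, cut at 0 to be nonnegative everywhere. Its integral is <Px, x> - t
   |x|^2 <= 0, so it vanishes almost everywhere, against s > t. *)
apply/eqP; pose f (s : R) := (Num.max (`|s| - t) 0).
have mf : measurable_fun setT (f : RR -> R).
  apply: (@measurable_maxr _ _ _ _ (fun s : RR => `|s| - t) (cst 0)) => //.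
  apply: measurable_funB => //; exact: normr_measurable.
have f0 s : 0 <= f s by rewrite /f le_max lexx orbT.
have : (absm x = \int[m x]_s (f s)%:E + (t * nrm2 x)%:E)%E.
  rewrite EFinM -spectral_setT -integral_cst// -ge0_integralD//; first last.
  - exact/measurable_EFinP.
  - by move=> *; rewrite lee_fin.
  apply: ae_eq_integral => //; first exact: measurable_abs_fun.
    by apply: emeasurable_funD => //; exact/measurable_EFinP.
  apply: filterS aet => s ts _ /=; congr EFin; rewrite /f max_l ?subrK//.
  by rewrite subr_ge0 (le_trans (ltW ts))// ler_norm.
rewrite -(spectral_dot Px) => If.
have {}If : (\int[m x]_s `|(f s)%:E|)%E = 0%E.
  under eq_integral do rewrite gee0_abs ?lee_fin//.
  have : ((\int[m x]_s (f s)%:E) + (t * nrm2 x)%:E <= (t * nrm2 x)%:E)%E.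
    by rewrite -If lee_fin.
  rewrite -leeBrDr// subee// => If0; apply/eqP; rewrite eq_le If0/=.
  by apply: integral_ge0 => s _; rewrite lee_fin.
have mEf : measurable_fun setT (fun s : RR => (f s)%:E) by exact/measurable_EFinP.
have fae := (ae_eq_integral_abs (m x) measurableT mEf).1 If.
have : {ae m x, forall s : RR, False}.
  apply: filterS2 aet fae.
  move=> s ts /(_ I) [] /eqP; rewrite /f eq_le => /andP[].
  rewrite ge_max subr_le0 lexx andbT leNgt => /negP + _; apply.
  exact: lt_le_trans ts (ler_norm _).
move=> [N [mN N0 sN]]; apply: etrans N0; congr (m x _).
by apply/seteqP; split => // s _; apply: sN.
Qed.

End operator.
End spectral.

(** The generating family stable under intersection consists of the rays ]t, +oo[, while spectral
    projections are computed on ]-oo, t]; finite total mass allows passing to complements. *)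
Lemma measure_unique_rays (R : realType)
    (m1 m2 : {measure set (measurableTypeR R) -> \bar R}) :
  m1 setT = m2 setT -> (m1 setT < +oo)%E ->
  (forall t : R, m1 `]-oo, t]%classic = m2 `]-oo, t]%classic) ->
  forall A, measurable A -> m1 A = m2 A.
Proof.
move=> mT moo mt A mA.
have m2oo : (m2 setT < +oo)%E by rewrite -mT.
have fin (m : {measure set (measurableTypeR R) -> \bar R}) B :
    (m setT < +oo)%E -> measurable B -> (m B < +oo)%E.
  by move=> mo mB; apply: le_lt_trans mo; apply: le_measure; rewrite ?inE.
have mray t : measurable (`]-oo, t]%classic : set (measurableTypeR R)).
  exact: measurable_itv.
have ray (m : {measure set (measurableTypeR R) -> \bar R}) t :
    (m setT < +oo)%E ->
    m `]t, +oo[%classic = (m setT - m `]-oo, t]%classic)%E.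
  move=> mo; rewrite -setCitvl -setTD measureD ?setTI//; exact: mray.
have GA : (@RGenOInfty.G R).-sigma.-measurable A.
  by rewrite -RGenOInfty.measurableE.
apply: (@g_sigma_algebra_measure_unique _ R (measurableTypeR R)
  (@RGenOInfty.G R) _ (fun n => `]- (n%:R : R), +oo[%classic) _ _ m1 m2
  _ _ _ A GA).
- by move=> _ [x ->]; exact: measurable_itv.
- by move=> n; exists (- n%:R).
- apply/seteqP; split => // x _; exists (Num.trunc `|x|).+1 => //=.
  rewrite in_itv/= andbT ltrNl; apply: le_lt_trans (truncnS_gt `|x|).
  by rewrite -normrN ler_norm.
- move=> _ _ [x ->] [y ->]; exists (Num.max x y).
  apply/seteqP; split=> s /=; rewrite !in_itv/= !andbT gt_max.
    by case=> -> ->.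
  by move/andP.
- move=> _ [x ->]; rewrite !ray//.
  by rewrite mT mt.
- by move=> k; apply: fin => //; exact: measurable_itv.
Qed.

(** * Squared modulus and measurability of complex functions *)

Section complex_sqmod.
Context (R : realType).
Implicit Types a b z : R[i].

Lemma sqmod_ge0 z : 0 <= sqmod z. Proof. exact: sqr_ge0. Qed.

Lemma sqmodM a b : sqmod (a * b) = sqmod a * sqmod b.
Proof. by rewrite /sqmod ComplexField.Normc.normcM exprMn. Qed.

Lemma sqmod_real (r : R) : sqmod r%:C = r ^+ 2.
Proof. by rewrite sqmodE/= expr0n addr0. Qed.

Lemma sqmod0 : sqmod 0 = 0 :> R.
Proof. by rewrite sqmod_real expr0n. Qed.

Lemma sqmod_eq0 z : sqmod z = 0 -> z = 0.
Proof.
by move=> /eqP; rewrite /sqmod sqrf_eq0 => /eqP /ComplexField.Normc.eq0_normc.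
Qed.

Lemma sqmodN z : sqmod (- z) = sqmod z.
Proof. by rewrite !sqmodE; case: z => a b /=; rewrite !sqrrN. Qed.

Lemma sqmodD_le a b : sqmod (a + b) <= 2 * sqmod a + 2 * sqmod b.
Proof. by have := sqmodP 1 a b; rewrite mul1r sqmod_real expr1n mulr1. Qed.

Lemma Re_mul_conj z : Re (z * conjc z) = sqmod z.
Proof. by rewrite sqmodE; case: z => a b /=; ring. Qed.

Lemma conjcMr (r : R) z : conjc (r%:C * z) = r%:C * conjc z.
Proof. by case: z => a b /=; congr (_ +i* _); ring. Qed.

Lemma Im_mul_conj z : Im (z * conjc z) = 0.
Proof. by case: z => a b /=; ring. Qed.

End complex_sqmod.

Section cmeasurable.
Context d (X : measurableType d) (R : realType).
Implicit Types (f g : X -> R[i]) (q : X -> R).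

Lemma cmeasurableM f g : cmeasurable f -> cmeasurable g ->
  cmeasurable (fun x => f x * g x).
Proof.
move=> [fr fi] [gr gi]; split.
- rewrite (_ : (fun _ => _) =
    (fun x => Re (f x) * Re (g x) - Im (f x) * Im (g x))); last first.
    by apply/funext => x; case: (f x) => ? ?; case: (g x).
  by apply: measurable_funB; apply: measurable_funM.
- rewrite (_ : (fun _ => _) =
    (fun x => Re (f x) * Im (g x) + Im (f x) * Re (g x))); last first.
    by apply/funext => x; case: (f x) => ? ?; case: (g x).
  by apply: measurable_funD; apply: measurable_funM.
Qed.

Lemma cmeasurable_real q : measurable_fun setT q ->
  cmeasurable (fun x => (q x)%:C).
Proof. by move=> mq; split => //=; exact: measurable_cst. Qed.

Lemma cmeasurable_comp (phi : X -> X) f : measurable_fun setT phi ->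
  cmeasurable f -> cmeasurable (fun x => f (phi x)).
Proof.
move=> mphi [fr fi]; split.
- exact: (measurableT_comp fr mphi).
- exact: (measurableT_comp fi mphi).
Qed.

Lemma measurable_sqmod_fun f : cmeasurable f ->
  measurable_fun setT (fun x => sqmod (f x)).
Proof. by move=> mf; apply/measurable_EFinP; exact: measurable_sqmod. Qed.

End cmeasurable.

Lemma ge0_integral_lincomb d (X : measurableType d) (R : realType)
    (mu : {measure set X -> \bar R}) (a b : R) (u v : X -> R) :
  0 <= a -> 0 <= b -> measurable_fun setT u -> measurable_fun setT v ->
  (forall x, 0 <= u x) -> (forall x, 0 <= v x) ->
  (\int[mu]_x (a * u x + b * v x)%:E =
   a%:E * \int[mu]_x (u x)%:E + b%:E * \int[mu]_x (v x)%:E)%E.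
Proof.
move=> a0 b0 mu' mv u0 v0.
under eq_integral do rewrite EFinD !EFinM.
rewrite ge0_integralD//.
- rewrite !ge0_integralZl//; first [exact/measurable_EFinP|
    by move=> x _; rewrite lee_fin].
- by move=> x _; rewrite -EFinM lee_fin mulr_ge0.
- by apply/measurable_EFinP; exact: measurable_funM.
- by move=> x _; rewrite -EFinM lee_fin mulr_ge0.
- by apply/measurable_EFinP; exact: measurable_funM.
Qed.

(** * Multiplication operators in L2 *)

Section L2_tools.
Context d (X : measurableType d) (R : realType) (mu : {measure set X -> \bar R}).
Implicit Types (f g : X -> R[i]) (q : X -> R) (F G K : L2 mu) (A : set X).

Definition sqint f : \bar R := (\int[mu]_x (sqmod (f x))%:E)%E.

Lemma sqint_ge0 f : (0 <= sqint f)%E.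
Proof. by apply: integral_ge0 => x _; rewrite lee_fin sqmod_ge0. Qed.

Lemma sqint_ae f g : cmeasurable f -> cmeasurable g ->
  {ae mu, forall x, f x = g x} -> sqint f = sqint g.
Proof.
move=> mf mg fg; apply: ge0_ae_eq_integral => //.
- exact: measurable_sqmod.
- exact: measurable_sqmod.
- by move=> x _; rewrite lee_fin sqmod_ge0.
- by move=> x _; rewrite lee_fin sqmod_ge0.
- by apply: filterS fg => x -> _.
Qed.

Lemma sqint_eq0 f : cmeasurable f -> sqint f = 0%E -> {ae mu, forall x, f x = 0}.
Proof.
move=> mf f0.
have : (\int[mu]_x `|(sqmod (f x))%:E| = 0)%E.
  by under eq_integral do rewrite gee0_abs ?lee_fin ?sqmod_ge0//.
move=> /(ae_eq_integral_abs mu measurableT (measurable_sqmod mf)).1.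
by apply: filterS => x /= /(_ I) [] /sqmod_eq0.
Qed.

Lemma cmeasurable_L2 F : cmeasurable F.
Proof. exact: (L2P F).1. Qed.

Lemma sqint_nrm2 F : sqint F = (nrm2 F)%:E.
Proof.
rewrite /nrm2 -[dot F F]/(L2_dot F F) L2_dotE /= /Rintegral fineK//.
by rewrite ge0_fin_numE ?sqint_ge0//; exact: (L2P F).2.
Qed.

Lemma eq_L2 F G : {ae mu, forall x, F x = G x} -> F = G.
Proof. by move=> FG; apply/L2_eqP; apply: filterS FG. Qed.

Lemma L2_aeD F G : {ae mu, forall x, L2_fun (F + G) x = F x + G x}.
Proof. by have := L2_addE F G; apply: filterS => x; apply. Qed.

Lemma L2_aeZ a F : {ae mu, forall x, L2_fun (a *: F) x = a * F x}.
Proof. by have := L2_scaleE a F; apply: filterS => x; apply. Qed.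

Lemma L2_aeP a F G : {ae mu, forall x, L2_fun (a *: F + G) x = a * F x + G x}.
Proof. by apply: filterS2 (L2_aeD (a *: F) G) (L2_aeZ a F) => x -> ->. Qed.

Lemma L2_aeN F : {ae mu, forall x, L2_fun (- F) x = - F x}.
Proof.
by rewrite -scaleN1r; have := L2_aeZ (-1) F; apply: filterS => x; rewrite mulN1r.
Qed.

Lemma L2_aeB F G : {ae mu, forall x, L2_fun (F - G) x = F x - G x}.
Proof. by apply: filterS2 (L2_aeD F (- G)) (L2_aeN G) => x -> ->. Qed.

Lemma L2_ae0 : {ae mu, forall x, L2_fun (0 : L2 mu) x = 0}.
Proof.
by rewrite -(scale0r (0 : L2 mu)); have := L2_aeZ 0 (0 : L2 mu);
  apply: filterS => x; rewrite mul0r.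
Qed.

(** The default is 0 when no element of L2 agrees with [f] almost everywhere. Being total, it lets
    an image be written down before its integrability is checked. *)
Definition toL2 f : L2 mu := xget 0 [set F : L2 mu | {ae mu, forall x, F x = f x}].

Lemma toL2E f : square_integrable mu f -> {ae mu, forall x, toL2 f x = f x}.
Proof.
move=> sf; have fP : f \in l2pred mu by rewrite inE.
apply: (@xgetPex _ 0 [set F : L2 mu | {ae mu, forall x, F x = f x}]).
exists (\pi_(L2 mu) (L2Fun fP))%qT => /=.
by have := L2_piE (L2Fun fP); apply: filterS => x; apply.
Qed.

Lemma dot_ae F G F' G' :
  {ae mu, forall x, F x * conjc (G x) = F' x * conjc (G' x)} ->
  dot F G = dot F' G'.
Proof.
move=> FG; rewrite -[dot F G]/(L2_dot F G) -[dot F' G']/(L2_dot F' G').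
have [/measurable_int mr /measurable_int mi] := L2_mul_integrable F G.
have [/measurable_int mr' /measurable_int mi'] := L2_mul_integrable F' G'.
by congr (_ +i* _); apply: ae_Rintegral; try exact/measurable_EFinP;
  apply: filterS FG => x ->.
Qed.

Lemma dot_Re_ae F G (u : X -> R) : measurable_fun setT u ->
  {ae mu, forall x, Re (F x * conjc (G x)) = u x} ->
  Re (dot F G) = \int[mu]_x u x.
Proof.
move=> mu' FG; rewrite -[dot F G]/(L2_dot F G) /=.
have [/measurable_int mr /measurable_int mi] := L2_mul_integrable F G.
by apply: ae_Rintegral => //; [exact/measurable_EFinP|apply: filterS FG => x ->].
Qed.

Lemma dot_Im_ae F G (u : X -> R) : measurable_fun setT u ->
  {ae mu, forall x, Im (F x * conjc (G x)) = u x} ->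
  Im (dot F G) = \int[mu]_x u x.
Proof.
move=> mu' FG; rewrite -[dot F G]/(L2_dot F G) /=.
have [/measurable_int mr /measurable_int mi] := L2_mul_integrable F G.
by apply: ae_Rintegral => //; [exact/measurable_EFinP|apply: filterS FG => x ->].
Qed.

(** Both components being in L2 is the whole domain condition, so this is multiplication on its
    maximal domain. *)
Definition mulop q : set (L2 mu * L2 mu) :=
  [set p : L2 mu * L2 mu |
    {ae mu, forall x, L2_fun p.2 x = (q x)%:C * L2_fun p.1 x}].

Lemma mulop_toL2 q F : measurable_fun setT q ->
  (\int[mu]_x (q x ^+ 2 * sqmod (F x))%:E < +oo)%E ->
  mulop q (F, toL2 (fun x => (q x)%:C * F x)).
Proof.
move=> mq qF; apply: toL2E; split.
  by apply: cmeasurableM; [exact: cmeasurable_real|exact: cmeasurable_L2].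
by under eq_integral do rewrite sqmodM sqmod_real.
Qed.

Lemma mulop_sqint q F K : measurable_fun setT q -> mulop q (F, K) ->
  (\int[mu]_x (q x ^+ 2 * sqmod (F x))%:E)%E = (nrm2 K)%:E.
Proof.
move=> mq qFK; rewrite -sqint_nrm2.
rewrite -(@sqint_ae (fun x => (q x)%:C * F x) K).
- by apply: eq_integral => x _; rewrite sqmodM sqmod_real.
- by apply: cmeasurableM; [exact: cmeasurable_real|exact: cmeasurable_L2].
- exact: cmeasurable_L2.
- by apply: filterS qFK => x /= ->.
Qed.

Lemma mulop_opdom q : measurable_fun setT q -> opdom (mulop q) =
  [set F : L2 mu | (\int[mu]_x (q x ^+ 2 * sqmod (F x))%:E < +oo)%E].
Proof.
move=> mq; apply/seteqP; split => F /=.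
  by move=> [K] /(mulop_sqint mq) ->; exact: ltry.
by move=> qF; exists (toL2 (fun x => (q x)%:C * L2_fun F x)); exact: mulop_toL2.
Qed.

(** The bound on [q] is asked only where [F] is nonzero, so that truncations of an arbitrary [F] to
    level sets of [q] qualify. *)
Lemma mulop_bounded q F (c : R) : measurable_fun setT q ->
  {ae mu, forall x, F x != 0 -> `|q x| <= c} ->
  mulop q (F, toL2 (fun x => (q x)%:C * F x)).
Proof.
move=> mq qc; apply: mulop_toL2 => //.
have mF := measurable_sqmod_fun (cmeasurable_L2 F).
apply: (@le_lt_trans _ _ ((c ^+ 2)%:E * sqint F)%E); last first.
  by rewrite sqint_nrm2 -EFinM ltry.
rewrite -ge0_integralZl//; last 3 first.
- exact/measurable_EFinP.
- by move=> x _; rewrite lee_fin sqmod_ge0.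
- by rewrite lee_fin sqr_ge0.
apply: ae_ge0_le_integral => //.
- by move=> x _; rewrite lee_fin mulr_ge0 ?sqr_ge0// sqmod_ge0.
- by apply/measurable_EFinP; apply: measurable_funM => //; exact: measurable_funX.
- by move=> x _; rewrite -EFinM lee_fin mulr_ge0 ?sqr_ge0// sqmod_ge0.
- by apply/measurable_EFinP; apply: measurable_funM.
apply: filterS qc => x qc _; rewrite -EFinM lee_fin.
have [->|F0] := eqVneq (F x) 0; first by rewrite sqmod0 !mulr0.
rewrite ler_wpM2r ?sqmod_ge0// -(real_normK (num_real (q x))).
by rewrite lerXn2r ?nnegrE// ?qc// (le_trans _ (qc F0)).
Qed.

Lemma mulop_linear q : linear_operator (mulop q).
Proof.
split.
- move=> F G K FG FK; apply: eq_L2.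
  by apply: filterS2 FG FK => x /= -> ->.
- by rewrite /mulop/=; apply: filterS L2_ae0 => x ->; rewrite mulr0.
- move=> a [F F'] [G G'] /= FF' GG'; rewrite /mulop/=.
  apply: filterS2 (filterI (L2_aeP a F G) (L2_aeP a F' G')) (filterI FF' GG').
  move=> x [-> ->] [/= -> ->].
  by rewrite mulrDr; congr (_ + _); rewrite mulrCA.
Qed.

Lemma mulop_sym q F F' G G' : mulop q (F, F') -> mulop q (G, G') ->
  dot F' G = dot F G'.
Proof.
move=> FF' GG'; apply: dot_ae; apply: filterS2 FF' GG' => x /= -> ->.
by rewrite conjcMr mulrCA mulrA.
Qed.

Definition restr A F : L2 mu := toL2 (fun x => (\1_A x)%:C * F x).

Lemma restrE A F : measurable A ->
  {ae mu, forall x, restr A F x = (\1_A x)%:C * F x}.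
Proof.
move=> mA; apply: (@mulop_bounded (\1_A) F 1).
  exact: measurable_indic.
by apply: aeW => x _; rewrite indicE; case: (_ \in _); rewrite ?normr1 ?normr0.
Qed.

Lemma nrm2_restr A F : measurable A ->
  (nrm2 (restr A F))%:E = (\int[mu]_(x in A) (sqmod (F x))%:E)%E.
Proof.
move=> mA; rewrite -(@mulop_sqint \1_A F); last 2 first.
- exact: measurable_indic.
- exact: restrE.
rewrite [RHS]integral_mkcond; apply: eq_integral => x _.
rewrite patchE indicE; case: (_ \in _).
  by rewrite expr1n mul1r.
by rewrite expr0n mul0r.
Qed.

Lemma nrm2_restr_le A F : measurable A -> nrm2 (restr A F) <= nrm2 F.
Proof.
move=> mA; rewrite -lee_fin nrm2_restr// -sqint_nrm2.
apply: ge0_subset_integral => //.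
  by apply: measurable_sqmod; exact: cmeasurable_L2.
by move=> x _; rewrite lee_fin sqmod_ge0.
Qed.

Lemma nrm2_subr_restr A F : measurable A ->
  nrm2 (F - restr A F) = nrm2 (restr (~` A) F).
Proof.
move=> mA; congr nrm2; apply: eq_L2.
have h1 := L2_aeB F (restr A F); have h2 := restrE F mA.
have h3 := restrE F (measurableC mA).
apply: filterS2 (filterI h1 h2) h3 => x [-> ->] ->.
rewrite !indicE in_setC; case: (_ \in _) => /=.
  by rewrite mul1r mul0r subrr.
by rewrite mul0r mul1r subr0.
Qed.

(** The error is the mass of {r > n} for the finite measure |F|^2 dmu, and these sets decrease to
    the empty set. *)
Lemma restr_cvg F (r : X -> R) (e : R) : measurable_fun setT r -> 0 < e ->
  exists n : nat, forall i, (n <= i)%N ->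
    nrm2 (F - restr [set x | r x <= i%:R] F) < e.
Proof.
move=> mr e0.
have mA (n : nat) : measurable [set x | r x <= n%:R].
  rewrite -[X in measurable X]setTI; exact: measurable_fun_le.
pose B (n : nat) := ~` [set x | r x <= n%:R].
have mB n : measurable (B n) by exact: measurableC.
pose M : {measure set X -> \bar R} := weighted_measure mu (cmeasurable_L2 F).
have ME n : (nrm2 (F - restr [set x | r x <= n%:R] F))%:E = M (B n).
  by rewrite nrm2_subr_restr// nrm2_restr//; exact: mB.
have MT : (M setT < +oo)%E by exact: (L2P F).2.
have MB0 : (M (B 0%N) < +oo)%E.
  by apply: le_lt_trans MT; apply: le_measure; rewrite ?inE.
have : (M \o B) n @[n --> \oo] --> M (\bigcap_n B n).
  apply: (nonincreasing_cvg_mu MB0 mB); first exact: bigcapT_measurable.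
  move=> i j ij; apply/subsetPset => x; apply: contra_not => /= ri.
  by rewrite (le_trans ri)// ler_nat.
have -> : \bigcap_n B n = set0.
  rewrite -subset0 => x /(_ (Num.truncn (r x)).+1 I) []; apply: ltW.
  exact: truncnS_gt.
rewrite measure0 => /fine_cvgP[_] /cvgr_lt/(_ _ e0) [n _ Mn].
by exists n => i /Mn /=; rewrite -ME.
Qed.

(** Take A = {|q| <= n} and G = 1_A (K - q F), which lies in the domain of multiplication by [q].
    Then <1_A K, G> = <F, q G> = <1_A q F, G>, that is, |G|^2 = 0; the sets A exhaust the space.
    Together with symmetry, this is selfadjointness of multiplication by a real function. *)
Lemma mulop_adjoint q F K : measurable_fun setT q ->
  (forall G G', mulop q (G, G') -> dot K G = dot F G') -> mulop q (F, K).
Proof.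
move=> mq FK.
have mA (n : nat) : measurable [set x | `|q x| <= n%:R].
  rewrite -[X in measurable X]setTI; apply: measurable_fun_le => //.
  by apply: measurableT_comp => //; exact: normr_measurable.
suff : {ae mu, forall x, forall n : nat, `|q x| <= n%:R ->
    K x = (q x)%:C * F x}.
  apply: filterS => x /(_ (Num.truncn `|q x|).+1); apply.
  by rewrite ltW// truncnS_gt.
apply/ae_foralln => n; set A := [set x | `|q x| <= n%:R].
have q1 : {ae mu, forall x, restr A F x != 0 -> `|q x| <= n%:R}.
  apply: filterS (restrE F (mA n)) => x ->; rewrite indicE.
  by case: (boolP (x \in A)) => [/[1!inE]//|_]; rewrite mul0r eqxx.
have := mulop_bounded mq q1; set F1 := toL2 _ => qF1.
pose G : L2 mu := restr A K - F1.
have GE : {ae mu, forall x, G x = (\1_A x)%:C * (K x - (q x)%:C * F x)}.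
  have h1 := L2_aeB (restr A K) F1; have h2 := restrE K (mA n).
  have h3 := restrE F (mA n).
  apply: filterS2 (filterI h1 h2) (filterI h3 qF1) => x [-> ->] [/= h3x ->].
  by rewrite h3x mulrBr; congr (_ - _); rewrite mulrCA.
have q2 : {ae mu, forall x, G x != 0 -> `|q x| <= n%:R}.
  apply: filterS GE => x ->; rewrite indicE.
  by case: (boolP (x \in A)) => [/[1!inE]//|_]; rewrite mul0r eqxx.
have := mulop_bounded mq q2; set G' := toL2 _ => qG'.
have A_idem x : (\1_A x : R)%:C * (\1_A x)%:C = (\1_A x)%:C.
  by rewrite indicE; case: (_ \in _); rewrite ?mulr1 ?mulr0.
have G0 : nrm2 G = 0.
  rewrite /nrm2 {1}/G dotBl.
  have -> : dot (restr A K) G = dot K G.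
    apply: dot_ae; apply: filterS2 GE (restrE K (mA n)) => x -> ->.
    by rewrite conjcMr [LHS]mulrACA A_idem [RHS]mulrCA.
  have -> : dot F1 G = dot F G'.
    apply: dot_ae; have h3 := restrE F (mA n).
    apply: filterS2 GE (filterI h3 (filterI qF1 qG')) => x Gx [h3x [/= -> ->]].
    rewrite h3x Gx !conjcMr.
    rewrite (_ : _ * _ = (q x)%:C * F x *
       ((\1_A x)%:C * (\1_A x)%:C * conjc (K x - (q x)%:C * F x))); last by ring.
    by rewrite A_idem; ring.
  by rewrite (FK _ _ qG') subrr.
apply: filterS2 GE (L2_ae0) => x; rewrite (nrm2_eq0 G0) => -> /eqP + qn.
rewrite mulf_eq0 => /orP[|]; last by rewrite subr_eq0 => /eqP.
by rewrite indicE mem_set// => /eqP/complexI/eqP; rewrite oner_eq0.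
Qed.

End L2_tools.

Lemma bernoulli_ge (R : realFieldType) (u : R) n : 0 <= u ->
  1 + u *+ n <= (1 + u) ^+ n.
Proof.
move=> u0; elim: n => [|n IH]; first by rewrite mulr0n addr0 expr0.
rewrite exprSr mulrSr; apply: le_trans (ler_wpM2r _ IH); last by rewrite addr_ge0.
rewrite -mulr_natr; have : 0 <= u * n%:R by rewrite mulr_ge0.
by have := mulr_ge0 u0 u0; nra.
Qed.

(** Division by t^(2n) leaves e b (1 + e/t)^(2n) <= t C, whose left side is unbounded in n by
    Bernoulli unless b = 0. For t = 0 the case n = 0 already decides. The even exponents are those
    of |p^n F|^2. *)
Lemma geometric_bound_eq0 (R : realType) (t e b C : R) :
  0 <= t -> 0 < e -> 0 <= b -> 0 <= C ->
  (forall n, e * (t + e) ^+ n.*2 * b <= t ^+ n.*2.+1 * C) -> b = 0.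
Proof.
move=> t0 e0 b0 C0 H; apply/eqP; rewrite eq_le b0 andbT leNgt; apply/negP => bp.
move: t0; rewrite le_eqVlt => /orP[/eqP t0|t0].
  have := H 0%N; rewrite double0 -t0 expr0 mulr1 expr1 mul0r leNgt.
  by rewrite mulr_gt0.
pose u := e / t; have u0 : 0 < u by rewrite divr_gt0.
pose n := (Num.truncn (t * C / (e * b * u))).+1.
have nE : t * C < e * b * u * n%:R.
  rewrite [ltRHS]mulrC -ltr_pdivrMr ?mulr_gt0 ?invr_gt0//; exact: truncnS_gt.
have {H} := H n; have -> : t + e = t * (1 + u) by rewrite /u; field; rewrite gt_eqF.
rewrite exprMn exprS -[leRHS]mulrA [leRHS]mulrCA.
rewrite (_ : _ * b = t ^+ n.*2 * (e * ((1 + u) ^+ n.*2 * b))); last by ring.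
rewrite ler_pM2l ?exprn_gt0//.
move=> Hn; have : u *+ n <= (1 + u) ^+ n.*2.
  apply: (@le_trans _ _ (1 + u *+ n.*2)); last exact/bernoulli_ge/ltW.
  rewrite -addnn mulrnDr addrA ler_wpDl// addr_ge0// mulrn_wge0// ltW//.
rewrite -mulr_natr => le1.
have : e * (u * n%:R * b) <= e * ((1 + u) ^+ n.*2 * b).
  by rewrite ler_pM2l// ler_pM2r.
by move: Hn nE; lra.
Qed.

(** * Spectral measure and functional calculus of a multiplication operator *)

Section multiplication.
Context d (X : measurableType d) (R : realType) (mu : {measure set X -> \bar R}).
Local Notation RR := (measurableTypeR R).
Variables (p : X -> R) (mp : measurable_fun setT p).
Implicit Types (F G : L2 mu).

(** The image of |F|^2 dmu under [p], that is, the scalar spectral measure at [F] of multiplication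
    by [p]. The canonical instance is named in order to obtain a bundled measure. *)
Definition l2dist F : {measure set RR -> \bar R} :=
  @measure_function_pushforward__canonical__measure_function_Measure _ _ X RR R
    (weighted_measure mu (cmeasurable_L2 F)) p mp.

Lemma l2distE F (D : set RR) :
  l2dist F D = (\int[mu]_(x in p @^-1` D) (sqmod (F x))%:E)%E.
Proof. by []. Qed.

Lemma integral_l2dist F (f : RR -> \bar R) : measurable_fun setT f ->
  (\int[l2dist F]_t f t = \int[mu]_x (f (p x) * (sqmod (F x))%:E))%E.
Proof.
move=> mf; apply: (integral_image_density (phi := p : X -> RR)) => //.
- exact: measurable_sqmod_fun (cmeasurable_L2 F).
- by move=> x; exact: sqmod_ge0.
Qed.

Lemma measurable_preimage_R (D : set RR) : measurable D -> measurable (p @^-1` D).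
Proof. by move=> mD; rewrite -[_ @^-1` _]setTI; exact: mp. Qed.

Lemma restr_linear (A : set X) : measurable A -> linear (@restr _ X R mu A).
Proof.
move=> mA a F G; apply: eq_L2.
apply: filterS2 (filterI (restrE F mA) (restrE G mA)) (filterI (L2_aeP a F G)
  (filterI (restrE (a *: F + G) mA) (L2_aeP a (restr A F) (restr A G)))).
move=> x [r1 r2] [FG [-> ->]]; rewrite FG.
by rewrite r1 r2 mulrDr; congr (_ + _); rewrite mulrCA.
Qed.

Lemma restrB (A : set X) F G : measurable A ->
  restr A (F - G) = restr A F - restr A G.
Proof.
move=> mA; have := restr_linear mA (-1) G F.
by rewrite !scaleN1r ![- _ + _]addrC.
Qed.

Lemma restr_idem (A : set X) F : measurable A -> restr A (restr A F) = restr A F.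
Proof.
move=> mA; apply: eq_L2.
apply: filterS2 (restrE F mA) (restrE (restr A F) mA) => x -> ->.
by rewrite mulrA indicE; case: (_ \in _); rewrite ?mulr1// !mul0r.
Qed.

Lemma restr_sym (A : set X) F G : measurable A ->
  dot (restr A F) G = dot F (restr A G).
Proof.
move=> mA; apply: (@mulop_sym _ _ _ _ \1_A); exact: restrE.
Qed.

Lemma restr_spectral : (forall x, 0 <= p x) ->
  spectral_measure (fun D => @restr _ X R mu (p @^-1` D)) l2dist.
Proof.
move=> p0; split.
- move=> D mD; have mpD := measurable_preimage_R mD.
  split; [exact: restr_linear|by move=> F; exact: restr_idem|].
  by move=> F G; exact: restr_sym.
- move=> F; have -> : p @^-1` `[0, +oo[%classic = setT.
    by apply/seteqP; split => // x _ /=; rewrite in_itv/= andbT.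
  apply: eq_L2; apply: filterS (restrE F measurableT) => x ->.
  by rewrite indicT mul1r.
- move=> F D mD; have mpD := measurable_preimage_R mD.
  rewrite l2distE -nrm2_restr//; congr EFin.
  by rewrite /nrm2 [in LHS]restr_sym// restr_idem// -restr_sym.
Qed.

Lemma mulop_dot (q : X -> R) F G : measurable_fun setT q -> mulop q (F, G) ->
  dot G F = (\int[mu]_x (q x * sqmod (F x)))%:C.
Proof.
move=> mq qFG; have mF := measurable_sqmod_fun (cmeasurable_L2 F).
have qE : {ae mu, forall x, G x * conjc (F x) = (q x * sqmod (F x))%:C}.
  apply: filterS qFG => x /= ->; rewrite -mulrA rmorphM/=; congr (_ * _).
  by apply/eqP; rewrite eq_complex Re_mul_conj Im_mul_conj/= !eqxx.
rewrite [LHS]complexE (@dot_Re_ae _ _ _ _ G F (fun x => q x * sqmod (F x)));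
  last 2 first.
- exact: measurable_funM.
- by apply: filterS qE => x ->.
rewrite (@dot_Im_ae _ _ _ _ G F (fun => 0)); last 2 first.
- exact: measurable_cst.
- by apply: filterS qE => x ->.
by rewrite /Rintegral integral0 mulr0 addr0.
Qed.

Lemma mulop_spectral_integral (f : R -> R) : measurable_fun setT f ->
  spectral_integral l2dist f (@mulop _ X R mu (f \o p)).
Proof.
move=> mf; have mfp : measurable_fun setT (f \o p) by exact: measurableT_comp.
split; first exact: mulop_linear.
- rewrite mulop_opdom//; apply/seteqP; split => F /=; rewrite integral_l2dist//;
    by [|apply/measurable_EFinP; apply: measurable_funX].
- move=> F G FG; rewrite (mulop_dot mfp FG); congr (_%:C).
  by rewrite /Rintegral integral_l2dist//; exact/measurable_EFinP.
Qed.

(** Both operators have the same domain and the same quadratic form, so by polarization <Q F, G> =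
    <f(p) F, G> = <F, f(p) G> for G in that domain; selfadjointness of the multiplication then
    identifies Q F. *)
Lemma spectral_integral_unique (m : L2 mu -> {measure set RR -> \bar R})
    (f : R -> R) Q : measurable_fun setT f ->
  (forall F D, measurable D -> m F D = l2dist F D) ->
  spectral_integral m f Q -> Q = mulop (f \o p).
Proof.
move=> mf ml [[svQ Q0 linQ] domQ dotQ].
have mfp : measurable_fun setT (f \o p) by exact: measurableT_comp.
have [[svM M0 linM] domM dotM] := mulop_spectral_integral mf.
have mlI F (u : RR -> \bar R) : (\int[m F]_t u t = \int[l2dist F]_t u t)%E.
  by apply: eq_measure_integral => D mD _; exact: ml.
have domE : opdom Q = opdom (mulop (f \o p)).
  by rewrite domQ domM; apply/seteqP; split => F /=; rewrite mlI.
have QM F K : Q (F, K) -> mulop (f \o p) (F, K).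
  move=> QFK; apply: mulop_adjoint => // G G' MG.
  (* Operators being graphs, their difference becomes a function by selecting values;
     single-valuedness makes the selection the right one on the common domain. *)
  pose T F := xget 0 [set Y | Q (F, Y)] - xget 0 [set Y | mulop (f \o p) (F, Y)].
  have TE F1 Y1 Y2 : Q (F1, Y1) -> mulop (f \o p) (F1, Y2) -> T F1 = Y1 - Y2.
    move=> q1 m1; congr (_ - _).
      by apply: (svQ F1) => //; apply: (@xgetPex _ 0 [set Y | Q (F1, Y)]); exists Y1.
    apply: (svM F1) => //.
    by apply: (@xgetPex _ 0 [set Y | mulop (f \o p) (F1, Y)]); exists Y2.
  have DE F1 : opdom Q F1 -> exists Y1 Y2, Q (F1, Y1) /\ mulop (f \o p) (F1, Y2).
    move=> QF1; have [Y1 q1] := QF1.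
    by move: QF1; rewrite domE => -[Y2 m1]; exists Y1, Y2.
  have QF : opdom Q F by exists K.
  have QG : opdom Q G by rewrite domE; exists G'.
  have := @polarization_eq0 R (L2 mu) (opdom Q) T.
  move=> /(_ _ _ _ F G QF QG).
  have [_ [K' [_ MF]]] := DE _ QF.
  rewrite (TE _ _ _ QFK MF) dotBl => TT.
  have /eqP : dot K G - dot K' G = 0.
    apply: TT.
    - by move=> a x y [x' qx] [y' qy]; exists (a *: x' + y'); exact: (linQ a _ _ qx qy).
    - move=> a x y /DE[x1 [x2 [qx mx]]] /DE[y1 [y2 [qy my]]].
      rewrite (TE _ _ _ (linQ a _ _ qx qy) (linM a _ _ mx my)).
      rewrite (TE _ _ _ qx mx) (TE _ _ _ qy my).
      by rewrite scalerBr opprD addrACA.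
    - move=> x /DE[x1 [x2 [qx mx]]]; rewrite (TE _ _ _ qx mx) dotBl.
      rewrite (dotQ _ _ qx) (dotM _ _ mx) /Rintegral mlI.
      by rewrite subrr.
  rewrite subr_eq0 => /eqP ->; exact: mulop_sym MF MG.
apply/seteqP; split => -[F K]; first exact: QM.
move=> MFK; have : opdom Q F by rewrite domE; exists K.
by move=> [K' QFK']; rewrite (svM F K K' MFK (QM _ _ QFK')).
Qed.

End multiplication.

(** * Uniqueness of the spectral measure of a multiplication operator *)

Section spectral_uniqueness.
Context d (X : measurableType d) (R : realType) (mu : {measure set X -> \bar R}).
Local Notation RR := (measurableTypeR R).
Variables (p : X -> R) (mp : measurable_fun setT p) (p0 : forall x, 0 <= p x).
Variables (E : set RR -> L2 mu -> L2 mu) (m : L2 mu -> {measure set RR -> \bar R}).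
Hypotheses (Em : spectral_measure E m) (mP : spectral_integral m id (mulop p)).
Implicit Types F G : L2 mu.
Local Notation D t := (`]-oo, t]%classic : set RR).

Let mD t : measurable (D t). Proof. exact: measurable_itv. Qed.

Let symP F F' G G' : mulop p (F, F') -> mulop p (G, G') -> dot F' G = dot F G'.
Proof. exact: mulop_sym. Qed.

Lemma mulop_dot_ge0 F F' : mulop p (F, F') ->
  (Re (dot F' F))%:E = (\int[mu]_x (p x * sqmod (F x))%:E)%E.
Proof.
move=> FF'; rewrite (mulop_dot mp FF')/= /Rintegral fineK//.
rewrite ge0_fin_numE; last first.
  by apply: integral_ge0 => x _; rewrite lee_fin mulr_ge0// sqmod_ge0.
have mF := measurable_sqmod_fun (cmeasurable_L2 F).
apply: (@le_lt_trans _ _ (\int[mu]_x ((sqmod (F x))%:E +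
  (p x ^+ 2 * sqmod (F x))%:E))%E).
  apply: ge0_le_integral => //.
  - by move=> x _; rewrite lee_fin mulr_ge0// sqmod_ge0.
  - by apply/measurable_EFinP; exact: measurable_funM.
  - by apply: emeasurable_funD; apply/measurable_EFinP => //;
      apply: measurable_funM => //; exact: measurable_funX.
  - move=> x _; rewrite -EFinD lee_fin.
    have := sqmod_ge0 (F x); have := sqr_ge0 (p x - 1); have := p0 x.
    by move=> ? ? ?; rewrite -[leRHS]addr0; nra.
rewrite ge0_integralD//; last 4 first.
- by move=> x _; rewrite lee_fin sqmod_ge0.
- exact/measurable_EFinP.
- by move=> x _; rewrite lee_fin mulr_ge0 ?sqr_ge0// sqmod_ge0.
- by apply/measurable_EFinP; apply: measurable_funM => //; exact: measurable_funX.
by rewrite (mulop_sqint mp FF') -/(sqint mu F) sqint_nrm2 -EFinD ltry.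
Qed.

(** A vector of the range of [E (D t)] is in the domain of multiplication by [p], and its image is
    again in that range; so multiplication can be iterated without leaving L2. *)
Lemma spectral_iterate t F : 0 <= t -> E (D t) F = F -> forall n,
  exists2 G, E (D t) G = G & {ae mu, forall x, G x = (p x ^+ n)%:C * F x}.
Proof.
move=> t0 FE; elim=> [|n [G GE Gn]].
  by exists F => //; apply: aeW => x; rewrite expr0 mul1r.
have [G' GG'] : opdom (mulop p) G.
  apply: (spectral_bounded_dom Em mP (mD t) t0 _ GE).
  by move=> s; rewrite /= in_itv.
exists G'; first exact: (spectral_invariant Em mP symP GG' GE).
by apply: filterS2 Gn GG' => x /= -> ->; rewrite mulrA -rmorphM -exprS.
Qed.

(* All vectors p^n F stay in the range of E(]-oo, t]), whence
   \int (p - t) p^(2n) |F|^2 <= 0 for every n; were F nonzero where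
   p >= t + e, the left-hand side would grow like (t + e)^(2n). *)
Lemma spectral_support_le t F : 0 <= t -> E (D t) F = F ->
  {ae mu, forall x, F x != 0 -> p x <= t}.
Proof.
move=> t0 FE.
have mF := measurable_sqmod_fun (cmeasurable_L2 F).
pose A (k : nat) := [set x | t + k.+1%:R^-1 <= p x].
have mA k : measurable (A k).
  by rewrite -[X in measurable X]setTI; exact: measurable_fun_le.
suff H : {ae mu, forall x, forall k, A k x -> F x = 0}.
  apply: filterS H => x H; apply: contra_neqT; rewrite -ltNge => tp.
  (* With this k, 1/(k + 1) is at most p x - t: the sets [A k] exhaust {p > t}. *)
  pose k := Num.truncn (p x - t)^-1; apply: (H k); rewrite /A/=.
  rewrite addrC -lerBrDr invf_ple ?posrE ?subr_gt0//.
  by apply/ltW; exact: truncnS_gt.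
apply/ae_foralln => k; set e : R := k.+1%:R^-1.
have e0 : 0 < e by rewrite invr_gt0.
suff G0 : nrm2 (restr (A k) F) = 0.
  apply: filterS2 (restrE F (mA k)) (L2_ae0 mu) => x.
  rewrite (nrm2_eq0 G0) => -> /eqP + Ax.
  rewrite mulf_eq0 => /orP[|/eqP//].
  by rewrite indicE mem_set// => /eqP/complexI/eqP; rewrite oner_eq0.
apply: (@geometric_bound_eq0 _ t e _ (nrm2 F)) => //; [exact: nrm2_ge0..|].
move=> n; have [G GE Gn] := spectral_iterate t0 FE n.
have [G' GG'] : opdom (mulop p) G.
  apply: (spectral_bounded_dom Em mP (mD t) t0 _ GE).
  by move=> s; rewrite /= in_itv.
have le_t : Re (dot G' G) <= t * nrm2 G.
  rewrite -lee_fin (spectral_dot Em mP GG').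
  apply: (spectral_le Em (mD t)) => //; first exact: measurable_abs_fun.
  by move=> s; rewrite /= in_itv/= lee_fin => st s0; rewrite ger0_norm.
have mG := measurable_sqmod_fun (cmeasurable_L2 G).
have mR := measurable_sqmod_fun (cmeasurable_L2 (restr (A k) F)).
have te0 : 0 <= e * (t + e) ^+ n.*2.
  by rewrite mulr_ge0 ?exprn_ge0 ?addr_ge0// ltW.
have tn0 : 0 <= t ^+ n.*2.+1 by exact: exprn_ge0.
(* All terms are nonnegative, so it is enough to integrate a pointwise inequality; [le_t] then
   leaves the bound to prove. On [A k] the pointwise inequality uses p >= t + e; elsewhere t p^(2n)
   is at most p^(2n+1) or t^(2n+1), according to whether p >= t or not. *)
suff : (t%:E * (nrm2 G)%:E +
    (e * (t + e) ^+ n.*2)%:E * (nrm2 (restr (A k) F))%:E <=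
    1%:E * (Re (dot G' G))%:E + (t ^+ n.*2.+1)%:E * (nrm2 F)%:E)%E.
  by rewrite -!EFinM -!EFinD lee_fin => ?; lra.
have sq0 (K : L2 mu) x : 0 <= sqmod (K x) by exact: sqmod_ge0.
have psq0 x : 0 <= p x * sqmod (G x) by rewrite mulr_ge0.
have mpG : measurable_fun setT (fun x => p x * sqmod (G x)).
  exact: measurable_funM.
rewrite (mulop_dot_ge0 GG') -!sqint_nrm2 -!ge0_integral_lincomb//.
apply: ae_ge0_le_integral => //.
- by move=> x _; rewrite lee_fin addr_ge0// mulr_ge0.
- by apply/measurable_EFinP; apply: measurable_funD; apply: measurable_funM.
- by move=> x _; rewrite lee_fin addr_ge0// mulr_ge0.
- by apply/measurable_EFinP; apply: measurable_funD; apply: measurable_funM.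
apply: filterS2 Gn (restrE F (mA k)) => x Gx rx _; rewrite lee_fin.
have -> : sqmod (G x) = p x ^+ n.*2 * sqmod (F x).
  by rewrite Gx sqmodM sqmod_real -exprM muln2.
rewrite rx sqmodM sqmod_real mul1r; move: (sqmod _) (sqmod_ge0 (F x)) => f f0.
rewrite mulrA [in leLHS]mulrA [p x * _]mulrA -!mulrDl ler_wpM2r//.
have px0 := p0 x; rewrite indicE; case: (boolP (x \in A k)) => [|_].
  rewrite inE /A/= -/e => Ax; rewrite expr1n mulr1.
  have : (t + e) ^+ n.*2 <= p x ^+ n.*2.
    by rewrite lerXn2r// nnegrE// addr_ge0// ltW.
  have : 0 <= (t + e) ^+ n.*2 by rewrite exprn_ge0// addr_ge0// ltW.
  by move: Ax tn0 e0; nra.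
rewrite expr0n mulr0 addr0 exprS.
have [tp|pt] := leP t (p x).
  apply: (@le_trans _ _ (p x * p x ^+ n.*2)); last by rewrite lerDl mulr_ge0 ?exprn_ge0.
  by rewrite ler_wpM2r ?exprn_ge0.
apply: (@le_trans _ _ (t * t ^+ n.*2)); last by rewrite lerDr mulr_ge0 ?exprn_ge0.
by rewrite ler_wpM2l// lerXn2r ?nnegrE// ltW.
Qed.

(* F - E(]-oo, t]) F is supported in {p <= t}, like F, but its spectral measure
   lives on ]t, +oo[. *)
Lemma spectral_id_of_support t F : 0 <= t ->
  {ae mu, forall x, F x != 0 -> p x <= t} -> E (D t) F = F.
Proof.
move=> t0 Ft; apply/esym/eqP; rewrite -subr_eq0; apply/eqP.
set G := F - E (D t) F.
have E0 : E (D t) G = 0.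
  by rewrite (spectralB Em)// (spectral_idem Em)// subrr.
have Et := spectral_support_le t0 (spectral_idem Em F (mD t)).
have Gt : {ae mu, forall x, L2_fun G x != 0 -> p x <= t}.
  apply: filterS2 (L2_aeB F (E (D t) F)) (filterI Ft Et) => x -> [Fx Ex].
  have [F0|/Fx//] := eqVneq (F x) 0; have [E0'|/Ex//] := eqVneq (E (D t) F x) 0.
  by rewrite F0 E0' subrr eqxx.
have GG' : mulop p (G, toL2 mu (fun x => (p x)%:C * L2_fun G x)).
  apply: (mulop_bounded (c := t)) => //.
  by apply: filterS Gt => x Gx /Gx; rewrite ger0_norm.
apply: (spectral_gt Em mP t0 GG' E0).
have mG := measurable_sqmod_fun (cmeasurable_L2 G).
rewrite -lee_fin (mulop_dot_ge0 GG') EFinM -sqint_nrm2.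
rewrite -ge0_integralZl//; last 2 first.
- exact/measurable_EFinP.
- by move=> x _; rewrite lee_fin sqmod_ge0.
apply: ae_ge0_le_integral => //.
- by move=> x _; rewrite lee_fin mulr_ge0// sqmod_ge0.
- by apply/measurable_EFinP; exact: measurable_funM.
- by move=> x _; rewrite -EFinM lee_fin mulr_ge0// sqmod_ge0.
- by apply/measurable_EFinP; exact: measurable_funM.
apply: filterS Gt => x Gx _; rewrite -EFinM lee_fin.
have [->|/Gx pt] := eqVneq (L2_fun G x) 0; first by rewrite sqmod0 !mulr0.
by rewrite ler_wpM2r ?sqmod_ge0.
Qed.

(** By the two preceding lemmas, the range of [E (D t)] consists of the functions supported in {p <=
    t}. Two orthogonal projections with the same range coincide. *)
Lemma spectral_restr t F : 0 <= t ->
  E (D t) F = restr [set x | p x <= t] F.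
Proof.
move=> t0; set A := [set x | p x <= t].
have mA : measurable A.
  by rewrite -[X in measurable X]setTI; exact: measurable_fun_le.
have EA : E (D t) (restr A F) = restr A F.
  apply: spectral_id_of_support => //; apply: filterS (restrE F mA) => x ->.
  rewrite indicE; case: (boolP (x \in A)) => [/[1!inE]//|_].
  by rewrite mul0r eqxx.
apply/eqP; rewrite -subr_eq0 -EA -(spectralB Em)//; apply/eqP.
set G := E _ _; apply: nrm2_eq0; rewrite /nrm2 {1}/G (spectral_sym Em)//.
rewrite (spectral_idem Em)//.
have GA : restr A G = G.
  have := spectral_support_le t0 (spectral_idem Em (F - restr A F) (mD t)).
  rewrite -/G => Gt; apply: eq_L2.
  apply: filterS2 Gt (restrE G mA) => x Gx ->; rewrite indicE.
  case: (boolP (x \in A)) => [|]; first by rewrite mul1r.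
  rewrite mul0r; have [->//|/Gx px] := eqVneq (L2_fun G x) 0.
  by rewrite notin_setE /A/= px.
by rewrite -/G -GA -restr_sym// restrB// restr_idem// subrr dot0l.
Qed.

Lemma spectral_measure_unique F (B : set RR) : measurable B ->
  m F B = l2dist mp F B.
Proof.
move=> mB; apply: measure_unique_rays => //.
- by rewrite (spectral_setT Em) -sqint_nrm2 l2distE preimage_setT.
- by rewrite (spectral_setT Em) ltry.
move=> t; have [t0|t0] := leP 0 t.
  rewrite (spectral_nrm2 Em)// spectral_restr// nrm2_restr; last first.
    by rewrite -[X in measurable X]setTI; exact: measurable_fun_le.
  by rewrite l2distE; congr integral; apply/seteqP; split => x /=; rewrite in_itv.
rewrite l2distE (_ : _ @^-1` _ = set0); last first.
  rewrite -subset0 => x /=; rewrite in_itv/= => pt.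
  by have := le_lt_trans pt t0; rewrite ltNge p0.
rewrite integral_set0.
have mN : measurable (`]-oo, 0[%classic : set RR) by exact: measurable_itv.
apply: (subset_measure0 _ mN _ (spectral_lt0 Em F)) => //.
by move=> s /=; rewrite !in_itv/= => st; exact: le_lt_trans st t0.
Qed.

End spectral_uniqueness.

(** Indicators of the preimages under [p] witness that a power exists. The power selected by [get]
    may come with another spectral measure, but the scalar measures of the latter are forced, and
    they determine the integral. *)
Lemma oppower_mulop d (X : measurableType d) (R : realType)
    (mu : {measure set X -> \bar R}) (p : X -> R) (a : R) :
  measurable_fun setT p -> (forall x, 0 <= p x) ->
  oppower (mulop p) a = mulop (fun x => p x `^ a) :> set (L2 mu * L2 mu).
Proof.
move=> mp p0; have ma := @measurable_powR R a.
have : is_oppower (mulop p : set (L2 mu * L2 mu)) a (oppower (mulop p) a).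
  apply: (@getPex _ (is_oppower (mulop p) a)).
  exists (mulop (fun x => p x `^ a)), (fun D => restr (p @^-1` D)), (l2dist mp).
  split; first exact: restr_spectral.
  - exact: (@mulop_spectral_integral _ _ _ mu p mp id (@measurable_id _ _ _)).
  - exact: (@mulop_spectral_integral _ _ _ mu p mp (fun t => t `^ a) ma).
move=> [E [m [Em mP mQ]]].
apply: (spectral_integral_unique ma _ mQ) => F D mD.
exact: (spectral_measure_unique mp p0 Em mP).
Qed.

(** * Weighted composition operators *)

(* k plays the role of h_{phi,v}: it is the density with respect to mu of the
   image under phi of |v|^2 dmu. *)
Section composition_density.
Context d (X : measurableType d) (R : realType) (mu : {measure set X -> \bar R}).
Variables (phi : X -> X) (mphi : measurable_fun setT phi).
Variables (v : X -> R[i]) (mv : cmeasurable v) (k : X -> \bar R).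
Hypotheses (mk : measurable_fun setT k) (k0 : forall x, (0 <= k x)%E).
Hypothesis vk : forall A, measurable A ->
  (\int[mu]_(x in phi @^-1` A) (sqmod (v x))%:E = \int[mu]_(x in A) k x)%E.
Implicit Types (F G : L2 mu) (u : X -> \bar R).

Let nu : {measure set X -> \bar R} :=
  @measure_function_pushforward__canonical__measure_function_Measure _ _ X X R
    (weighted_measure mu mv) phi mphi.

(** The measure [nu] is read in two ways: as the image under [phi] of |v|^2 dmu, and as k dmu, that
    is, its image under the identity. *)
Lemma ge0_integral_composition_set u A : measurable A ->
  measurable_fun setT u -> (forall x, 0 <= u x)%E ->
  (\int[mu]_(x in phi @^-1` A) (u (phi x) * (sqmod (v x))%:E) =
   \int[mu]_(x in A) (u x * k x))%E.
Proof.
move=> mA mu' u0; transitivity (\int[nu]_(x in A) u x)%E.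
  apply/esym/ge0_integral_image_density_set => //; first exact: measurable_sqmod.
  by move=> x; rewrite lee_fin sqmod_ge0.
exact: (ge0_integral_image_density_set (phi := id)).
Qed.

Lemma ge0_integral_composition u : measurable_fun setT u ->
  (forall x, 0 <= u x)%E ->
  (\int[mu]_x (u (phi x) * (sqmod (v x))%:E) = \int[mu]_x (u x * k x))%E.
Proof. exact: ge0_integral_composition_set. Qed.

(** For a null set N, the integral of |v|^2 over the preimage of N is that of k over N, hence 0: v
    vanishes almost everywhere on that preimage. This is what makes the operator independent of
    representatives. *)
Lemma composition_ae (P : X -> Prop) : {ae mu, forall x, P x} ->
  {ae mu, forall x, v x != 0 -> P (phi x)}.
Proof.
move=> [N [mN N0 PN]].
have mpN : measurable (phi @^-1` N) by rewrite -[_ @^-1` _]setTI; exact: mphi.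
have mvN := measurable_funTS (D := phi @^-1` N) (measurable_sqmod mv).
have : (\int[mu]_(x in phi @^-1` N) `|(sqmod (v x))%:E| = 0)%E.
  under eq_integral do rewrite gee0_abs ?lee_fin ?sqmod_ge0//.
  rewrite vk//; under eq_integral do rewrite -[k _]gee0_abs//.
  by rewrite integral_abs_eq0//; exact: measurable_funTS.
move=> /(ae_eq_integral_abs mu mpN mvN).1.
apply: filterS => x /= H vx; apply: contrapT => nP.
have : (phi @^-1` N) x by apply: PN.
by move=> /H [] /sqmod_eq0 v0; rewrite v0 eqxx in vx.
Qed.

Lemma measurable_L2_sqmod F : measurable_fun setT (fun x => (sqmod (F x))%:E).
Proof. by apply: measurable_sqmod; exact: cmeasurable_L2. Qed.

Lemma cmeasurable_weighted F : cmeasurable (fun x => v x * F (phi x)).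
Proof.
apply: cmeasurableM => //; apply: cmeasurable_comp => //.
exact: cmeasurable_L2.
Qed.

Lemma sqint_weighted F : sqint mu (fun x => v x * F (phi x)) =
  (\int[mu]_x ((sqmod (F x))%:E * k x))%E.
Proof.
rewrite -ge0_integral_composition//.
- by apply: eq_integral => x _; rewrite sqmodM EFinM muleC.
- exact: measurable_L2_sqmod.
- by move=> x; rewrite lee_fin sqmod_ge0.
Qed.

Lemma wcomp_nrm2 F G : wcomp mu v phi (F, G) ->
  (nrm2 G)%:E = (\int[mu]_x ((sqmod (F x))%:E * k x))%E.
Proof.
move=> FG; rewrite -sqint_nrm2 -sqint_weighted; apply: sqint_ae.
- exact: cmeasurable_L2.
- exact: cmeasurable_weighted.
- by apply: filterS FG => x; apply.
Qed.

Lemma wcompE F G : wcomp mu v phi (F, G) <->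
  {ae mu, forall x, G x = v x * F (phi x)}.
Proof. by split; apply: filterS => x //; apply. Qed.

Lemma wcomp_toL2 F : (\int[mu]_x ((sqmod (F x))%:E * k x) < +oo)%E ->
  wcomp mu v phi (F, toL2 mu (fun x => v x * F (phi x))).
Proof.
move=> Foo; apply/wcompE/toL2E; split; first exact: cmeasurable_weighted.
by rewrite -/(sqint mu _) sqint_weighted.
Qed.

Lemma wcomp_opdom : opdom (wcomp mu v phi) =
  [set F : L2 mu | (\int[mu]_x ((sqmod (F x))%:E * k x) < +oo)%E].
Proof.
apply/seteqP; split => F /=; first by move=> [G] /wcomp_nrm2 <-; exact: ltry.
by move=> /wcomp_toL2; exists (toL2 mu (fun x => v x * L2_fun F (phi x))).
Qed.

Lemma wcomp_linear : linear_operator (wcomp mu v phi).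
Proof.
split.
- move=> F G K /wcompE FG /wcompE FK; apply: eq_L2.
  by apply: filterS2 FG FK => x -> ->.
- apply/wcompE; apply: filterS2 (composition_ae (L2_ae0 mu)) (L2_ae0 mu).
  move=> x vx ->; have [->|/vx ->] := eqVneq (v x) 0; first by rewrite mul0r.
  by rewrite mulr0.
- move=> a [F F'] [G G'] /wcompE FF' /wcompE GG'; apply/wcompE.
  have h1 := composition_ae (L2_aeP a F G).
  apply: filterS2 (filterI h1 (L2_aeP a F' G')) (filterI FF' GG').
  move=> x [vx ->] [F'x G'x]; rewrite F'x G'x.
  have [->|/vx ->] := eqVneq (v x) 0; first by rewrite !mul0r mulr0 addr0.
  by rewrite mulrDr; congr (_ + _); rewrite mulrCA.
Qed.

End composition_density.

(** Since f is finite on S, the intersections of S with the pieces of finite measure and with the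
    sets {f <= m} exhaust S. They are countably many, so one of them is not null. *)
Lemma sigma_finite_subset d (X : measurableType d) (R : realType)
    (mu : {sigma_finite_measure set X -> \bar R}) (S : set X) (f : X -> \bar R) :
  measurable S -> mu S != 0%E -> measurable_fun setT f ->
  (forall x, 0 <= f x)%E -> (forall x, S x -> f x < +oo)%E ->
  exists T, [/\ measurable T, T `<=` S, (0 < mu T)%E, (mu T < +oo)%E &
    (\int[mu]_(x in T) f x < +oo)%E].
Proof.
move=> mS S0 mf f0 fS.
have [B BT Bfin] := sigma_finiteT mu.
pose T (n m : nat) := S `&` B n `&` [set x | f x <= m%:R%:E]%E.
have mT n m : measurable (T n m).
  apply: measurableI; first by apply: measurableI => //; exact: (Bfin n).1.
  have := mf measurableT _ (emeasurable_itv `]-oo, m%:R%:E]).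
  by rewrite setTI; congr measurable; apply/seteqP; split => x /=; rewrite in_itv.
have : exists n m, mu (T n m) != 0%E.
  apply: contrapT => /forallNP T0; move/eqP : S0; apply.
  have -> : S = \bigcup_n \bigcup_m T n m.
    apply/seteqP; split => x; last by move=> [n _ [m _ [[]]]].
    move=> Sx; have [n _ Bn] : (\bigcup_i B i) x by rewrite -BT.
    exists n => //; exists (Num.truncn (fine (f x))).+1 => //; split => //=.
    rewrite -[f x]fineK ?ge0_fin_numE ?fS// lee_fin ltW// truncnS_gt//.
  apply/negligibleP.
    by apply: bigcupT_measurable => n; exact: bigcupT_measurable.
  apply: negligible_bigcup => n; apply: negligible_bigcup => m.
  by apply/negligibleP => //; apply/eqP/negPn/negP => T1; apply: (T0 n); exists m.
move=> [n [m T0]]; exists (T n m).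
have Tfin : (mu (T n m) < +oo)%E.
  apply: le_lt_trans (Bfin n).2; apply: le_measure; rewrite ?inE//.
    exact: (Bfin n).1.
  by move=> x [[]].
split => //; first by move=> x [[]].
  by rewrite lt_def T0 measure_ge0.
apply: (@le_lt_trans _ _ (m%:R%:E * mu (T n m))%E); last first.
  by rewrite -[mu (T n m)]fineK ?ge0_fin_numE ?measure_ge0// -EFinM ltry.
rewrite -integral_cst//; apply: ge0_le_integral => //.
- exact: measurable_funTS.
- by move=> x [].
Qed.

(** The integral of |v|^2 over the preimage of {k = 0} is that of k over {k = 0}. *)
Lemma composition_gt0 d (X : measurableType d) (R : realType)
    (mu : {measure set X -> \bar R}) (phi : X -> X) (v : X -> R[i])
    (k : X -> \bar R) :
  measurable_fun setT phi -> cmeasurable v ->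
  measurable_fun setT k -> (forall x, 0 <= k x)%E ->
  (forall A, measurable A ->
    \int[mu]_(x in phi @^-1` A) (sqmod (v x))%:E = \int[mu]_(x in A) k x)%E ->
  {ae mu, forall x, v x != 0 -> (0 < k (phi x))%E}.
Proof.
move=> mphi mv mk k0 vk; set N := [set x | k x = 0%E].
have mN : measurable N by have := mk measurableT _ (emeasurable_set1 0%E); rewrite setTI.
have mpN : measurable (phi @^-1` N) by rewrite -[_ @^-1` _]setTI; exact: mphi.
have mvN := measurable_funTS (D := phi @^-1` N) (measurable_sqmod mv).
have : (\int[mu]_(x in phi @^-1` N) `|(sqmod (v x))%:E| = 0)%E.
  under eq_integral do rewrite gee0_abs ?lee_fin ?sqmod_ge0//.
  by rewrite vk// integral0_eq.
move=> /(ae_eq_integral_abs mu mpN mvN).1.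
apply: filterS => x /= H; apply: contra_neqT; rewrite lt_def k0 andbT negbK.
by move=> /eqP /H [] /sqmod_eq0.
Qed.

Section powR_facts.
Context (R : realType).
Implicit Types a y r : R.

(** The case y = 0 is included, thanks to the conventions for inverses and powers of 0. *)
Lemma powR_divM a y r : 0 <= a -> 0 <= y -> (a / y) `^ r = a `^ r * y `^ (- r).
Proof.
move=> a0 y0; rewrite powRM ?invr_ge0//; congr (_ * _).
by rewrite -powR_inv1// -powRrM mulN1r.
Qed.

Lemma sqr_powR a r : 0 <= a -> (a `^ (r / 2)) ^+ 2 = a `^ r.
Proof. by move=> a0; rewrite -powR_mulrn ?powR_ge0// -powRrM divfK. Qed.

Lemma sqr_powRN_half a : 0 <= a -> (a `^ (- 2^-1)) ^+ 2 = a^-1.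
Proof.
by move=> a0; rewrite -[- _]mulN1r sqr_powR// powR_inv1.
Qed.

Lemma powRN_half_mul a : 0 < a -> a `^ (- 2^-1) * a `^ 2^-1 = 1.
Proof. by move=> a0; rewrite powRN mulVf// gt_eqF// powR_gt0. Qed.

End powR_facts.

(** * Modulus, phase and Aluthge transform of a weighted composition operator *)

Section weighted_composition.
Context d (X : measurableType d) (R : realType) (mu : {measure set X -> \bar R}).
Variables (w : X -> R[i]) (mw : cmeasurable w).
Variables (phi : X -> X) (mphi : measurable_fun setT phi).
Variables (p : X -> R) (mp : measurable_fun setT p) (p0 : forall x, 0 <= p x).
Hypothesis wp : forall A, measurable A ->
  (\int[mu]_(x in phi @^-1` A) (sqmod (w x))%:E = \int[mu]_(x in A) (p x)%:E)%E.
Implicit Types F G : L2 mu.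
Local Notation A := (wcomp mu w phi).

Let mEp : measurable_fun setT (fun x => (p x)%:E).
Proof. exact/measurable_EFinP. Qed.

Let Ep0 x : (0 <= (p x)%:E)%E. Proof. by rewrite lee_fin. Qed.

Let nu : {measure set X -> \bar R} :=
  @measure_function_pushforward__canonical__measure_function_Measure _ _ X X R
    (weighted_measure mu mw) phi mphi.

Lemma Rintegral_composition (s : X -> R) : measurable_fun setT s ->
  \int[mu]_x (s (phi x) * sqmod (w x)) = \int[mu]_x (s x * p x).
Proof.
move=> ms; have msE : measurable_fun setT (EFin \o s) by exact/measurable_EFinP.
rewrite /Rintegral; congr fine; transitivity (\int[nu]_x (s x)%:E)%E.
  apply/esym; apply: (integral_image_density mphi _ _ _ msE) => //.
  - exact: measurable_sqmod_fun.
  - by move=> x; exact: sqmod_ge0.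
exact: (integral_image_density (phi := id) _ _ _ _ msE).
Qed.

(** Polarized form of |C F|^2 = int p |F|^2 dmu. The change of variables is applied to the real and
    imaginary parts of F' times the conjugate of F, which have no sign. *)
Lemma wcomp_dot F G F' G' M : A (F, G) -> A (F', G') -> mulop p (F', M) ->
  dot G' G = dot M F.
Proof.
move=> /wcompE FG /wcompE FG' F'M.
have mFF : cmeasurable (fun x => F' x * conjc (F x)).
  apply: cmeasurableM; first exact: cmeasurable_L2.
  have [mr mi] := cmeasurable_L2 F; split.
    rewrite (_ : (fun _ => _) = (fun x => Re (F x)))//.
    by apply/funext => x; case: (F x).
  rewrite (_ : (fun _ => _) = (fun x => - Im (F x))); first exact: measurable_funN.
  by apply/funext => x; case: (F x).
have [mr mi] := mFF; have mwq := measurable_sqmod_fun mw.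
have mphi' (s : X -> R) : measurable_fun setT s -> measurable_fun setT (s \o phi).
  by move=> ms; exact: measurableT_comp.
have GE : {ae mu, forall x, G' x * conjc (G x) =
    (sqmod (w x))%:C * (F' (phi x) * conjc (F (phi x)))}.
  apply: filterS2 FG FG' => x -> ->.
  rewrite sqmodE; case: (w x) (F (phi x)) (F' (phi x)) => a b [c e] [k l] /=.
  by congr (_ +i* _); ring.
have ME : {ae mu, forall x, M x * conjc (F x) =
    (p x)%:C * (F' x * conjc (F x))}.
  by apply: filterS F'M => x /= ->; rewrite mulrA.
rewrite [LHS]complexE [RHS]complexE; congr (_%:C + 'i * _%:C).
- rewrite (@dot_Re_ae _ _ _ _ G' G
    (fun x => Re (F' (phi x) * conjc (F (phi x))) * sqmod (w x))); last 2 first.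
  + by apply: measurable_funM => //; exact: mphi' mr.
  + by apply: filterS GE => x ->; case: (_ * conjc _) => a b /=; ring.
  rewrite (Rintegral_composition mr); apply/esym/dot_Re_ae.
    exact: measurable_funM.
  by apply: filterS ME => x ->; case: (_ * conjc _) => a b /=; ring.
- rewrite (@dot_Im_ae _ _ _ _ G' G
    (fun x => Im (F' (phi x) * conjc (F (phi x))) * sqmod (w x))); last 2 first.
  + by apply: measurable_funM => //; exact: mphi' mi.
  + by apply: filterS GE => x ->; case: (_ * conjc _) => a b /=; ring.
  rewrite (Rintegral_composition mi); apply/esym/dot_Im_ae.
    exact: measurable_funM.
  by apply: filterS ME => x ->; case: (_ * conjc _) => a b /=; ring.
Qed.

Lemma wcomp_opdomE : opdom A =
  [set F : L2 mu | (\int[mu]_x (p x * sqmod (F x))%:E < +oo)%E].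
Proof.
rewrite (wcomp_opdom mphi mw mEp Ep0 wp).
suff E F : (\int[mu]_x ((sqmod (F x))%:E * (p x)%:E) =
    \int[mu]_x (p x * sqmod (F x))%:E)%E.
  by apply/seteqP; split => F /=; rewrite E.
by apply: eq_integral => x _; rewrite -EFinM mulrC.
Qed.

Lemma mulop_opdom_wcomp F M : mulop p (F, M) -> opdom A F.
Proof.
by move=> FM; rewrite wcomp_opdomE/= -(mulop_dot_ge0 mp p0 FM) ltry.
Qed.

Lemma wcomp_normal : opcomp (adjoint A) A = mulop p.
Proof.
apply/seteqP; split => -[F K] /=.
  move=> [G AFG adjG]; apply: mulop_adjoint => // F' M F'M.
  have [G' AFG'] := mulop_opdom_wcomp F'M.
  have := adjG _ AFG' => /= H; rewrite (dotC M F) (dotC F' K).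
  by rewrite -H (wcomp_dot AFG AFG' F'M).
move=> FK; have [G AFG] := mulop_opdom_wcomp FK.
exists G => //= -[F' G'] AFG' /=.
by rewrite (dotC G G') (wcomp_dot AFG' AFG FK) -dotC.
Qed.

Lemma wcomp_opabs : opabs A = mulop (fun x => p x `^ 2^-1).
Proof. by rewrite /opabs wcomp_normal oppower_mulop. Qed.

(* The partial isometry of the polar decomposition is the weighted composition
   operator with this weight; 0 `^ (- 2^-1) = 0. *)
Definition phase x : R[i] := w x * (p (phi x) `^ (- 2^-1))%:C.

Let mpow r : measurable_fun setT (fun x => p x `^ r).
Proof. exact: (measurableT_comp (@measurable_powR R r) mp). Qed.

Lemma cmeasurable_phase : cmeasurable phase.
Proof.
apply: cmeasurableM => //; apply: cmeasurable_real.
exact: (measurableT_comp (mpow _) mphi).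
Qed.

Local Notation B := [set x | 0 < p x].

Let mB : measurable B.
Proof.
have := mp measurableT (measurable_itv `]0, +oo[); rewrite setTI.
by congr measurable; apply/seteqP; split => x /=; rewrite in_itv/= andbT.
Qed.

(** On {p > 0} the factors p^-1 and p cancel. The density being an indicator, the phase is defined
    on all of L2 and isometric on the functions supported in {p > 0}. *)
Lemma phase_density D : measurable D ->
  (\int[mu]_(x in phi @^-1` D) (sqmod (phase x))%:E =
   \int[mu]_(x in D) (\1_B x)%:E)%E.
Proof.
move=> mD.
transitivity (\int[mu]_(x in D) ((((p x) `^ (- 2^-1)) ^+ 2)%:E * (p x)%:E))%E.
  rewrite -(ge0_integral_composition_set mphi mw mEp Ep0 wp)//.
  - by apply: eq_integral => x _; rewrite sqmodM sqmod_real mulrC.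
  - by apply/measurable_EFinP; exact: measurable_funX.
  - by move=> x; rewrite lee_fin sqr_ge0.
apply: eq_integral => x _; rewrite sqr_powRN_half// -EFinM indicE; congr EFin.
have [px|px] := ltP 0 (p x); first by rewrite mem_set// mulVf// gt_eqF.
have -> : p x = 0 by apply/eqP; rewrite eq_le px p0.
by rewrite mulr0 memNset//= ltNge px.
Qed.

Let m1B : measurable_fun setT (fun x => (\1_B x : R)%:E).
Proof. by apply/measurable_EFinP; exact: measurable_indic. Qed.

Let B0 x : (0 <= (\1_B x : R)%:E)%E. Proof. by rewrite lee_fin. Qed.

Lemma phase_opdom F : (\int[mu]_x ((sqmod (F x))%:E * (\1_B x)%:E) < +oo)%E.
Proof.
apply: le_lt_trans (L2P F).2; apply: ge0_le_integral => //.
- by move=> x _; rewrite mule_ge0// lee_fin sqmod_ge0.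
- by apply: emeasurable_funM => //; exact: measurable_L2_sqmod.
- exact: measurable_L2_sqmod.
- by move=> x _; rewrite -EFinM lee_fin ler_piMr ?sqmod_ge0.
Qed.

Definition phase_op F : L2 mu := toL2 mu (fun x => phase x * F (phi x)).

Lemma phase_opP F : wcomp mu phase phi (F, phase_op F).
Proof.
exact: (wcomp_toL2 mphi cmeasurable_phase m1B B0 phase_density (phase_opdom F)).
Qed.

Lemma phase_opE F : {ae mu, forall x, phase_op F x = phase x * F (phi x)}.
Proof. exact/wcompE/phase_opP. Qed.

Lemma phase_op_nrm2 F : nrm2 (phase_op F) = nrm2 (restr B F).
Proof.
apply: EFin_inj; rewrite nrm2_restr//.
rewrite (wcomp_nrm2 mphi cmeasurable_phase m1B B0 phase_density (phase_opP F)).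
by rewrite [RHS]integral_mkcond; apply: eq_integral => x _; rewrite epatch_indic.
Qed.

Lemma phase_op_linear : linear phase_op.
Proof.
have [sv _ lin] :=
  wcomp_linear mphi cmeasurable_phase m1B B0 phase_density.
move=> a F G; apply: (sv (a *: F + G)); first exact: phase_opP.
exact: (lin a (F, phase_op F) (G, phase_op G) (phase_opP F) (phase_opP G)).
Qed.

Lemma phase_opB F G : phase_op (F - G) = phase_op F - phase_op G.
Proof.
have := phase_op_linear (-1) G F.
by rewrite !scaleN1r ![- _ + _]addrC.
Qed.

Lemma phase_op_contraction F G : nrm2 (phase_op F - phase_op G) <= nrm2 (F - G).
Proof. by rewrite -phase_opB phase_op_nrm2 nrm2_restr_le. Qed.

Lemma w_support : {ae mu, forall x, w x != 0 -> 0 < p (phi x)}.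
Proof.
have := composition_gt0 mphi mw mEp Ep0 wp.
by apply: filterS => x.
Qed.

Lemma phase_mulop_half F Y : mulop (fun x => p x `^ 2^-1) (F, Y) ->
  {ae mu, forall x, phase_op Y x = w x * F (phi x)}.
Proof.
move=> FY; have := composition_ae mphi mw mEp Ep0 wp FY => /= FYphi.
apply: filterS2 (phase_opE Y) (filterI w_support FYphi) => x -> [wpos wY].
have [w0|wn0] := eqVneq (w x) 0; first by rewrite /phase w0 !mul0r.
rewrite wY// /phase -mulrA; congr (_ * _); rewrite mulrA -rmorphM/=.
by rewrite powRN_half_mul ?wpos// mul1r.
Qed.

Lemma mulop_half_opdom F : opdom A F ->
  exists Y, mulop (fun x => p x `^ 2^-1) (F, Y).
Proof.
rewrite wcomp_opdomE/= => Fp; suff : opdom (mulop (fun x => p x `^ 2^-1)) F by [].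
rewrite mulop_opdom//=.
by under eq_integral do rewrite -[2^-1]mul1r sqr_powR// powRr1//.
Qed.

Lemma phase_polar : is_polar_part A phase_op.
Proof.
split; last 1 first.
- rewrite wcomp_opabs; apply/seteqP; split => -[F G].
    move=> AFG; have [Y FY] : opdom (mulop (fun x => p x `^ 2^-1)) F.
      by apply: mulop_half_opdom; exists G.
    exists Y => //=; apply/esym; apply: eq_L2.
    by move/wcompE : AFG => FG; apply: filterS2 (phase_mulop_half FY) FG => x -> ->.
  move=> [Y FY]; rewrite /opgraph/= => ->; apply/wcompE; exact: phase_mulop_half FY.
- split; first exact: phase_op_linear.
    move=> F S /nbhs_nrm2P[r r0 rS]; apply/nbhs_nrm2P; exists r => // G FG.
    by apply: rS; apply: le_lt_trans FG; exact: phase_op_contraction.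
  move=> F Fker; rewrite !norm_nrm2 phase_op_nrm2; congr ((Num.sqrt _)%:C).
  have mC : measurable (~` B) by exact: measurableC.
  (* The part of F on {p = 0} belongs to the kernel, hence is orthogonal to F; its squared norm is
     this scalar product, so it vanishes and F is supported in [B]. *)
  have : phase_op (restr (~` B) F) = 0.
    apply: nrm2_eq0; rewrite phase_op_nrm2 -[RHS](@nrm20 _ (L2 mu)); congr nrm2.
    apply: eq_L2; apply: filterS2 (restrE F mC)
      (filterI (restrE (restr (~` B) F) mB) (L2_ae0 mu)) => x h1 [h2 ->].
    rewrite h2 h1 !indicE in_setC; case: (_ \in _) => /=; first by rewrite mul0r mulr0.
    by rewrite mul0r.
  move=> /Fker; rewrite -(restr_idem F mC) -restr_sym// => F0.
  have /nrm2_eq0 : nrm2 (restr (~` B) F) = 0 by rewrite /nrm2 F0.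
  move=> BF0; have := nrm2_subr_restr F mB; rewrite BF0 nrm20 => /nrm2_eq0/eqP.
  by rewrite subr_eq0 => /eqP <-.
- move=> F; split.
    move=> UF; apply/wcompE.
    apply: filterS2 (filterI (phase_opE F) w_support) (L2_ae0 mu).
    move=> x [+ wpos] F0; rewrite UF F0.
    have [->|w0] := eqVneq (w x) 0; first by rewrite mul0r.
    move=> /esym/eqP; rewrite /phase -mulrA mulrCA mulf_eq0 => /orP[|/eqP//].
    by move=> /eqP/complexI/eqP; rewrite gt_eqF// powR_gt0// wpos.
  move=> /wcompE AF; apply: eq_L2.
  apply: filterS2 (filterI (phase_opE F) AF) (L2_ae0 mu) => x [-> +] F0.
  by rewrite F0 /phase mulrAC => <-; rewrite mul0r.
Qed.

(** The selected U need not be [phase_op] by construction. Both factor the operator through the same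
    modulus, so they agree on the range of the modulus; they also share the kernel, and both are
    continuous. *)
Lemma polar_part_wcomp : polar_part A = phase_op.
Proof.
have : is_polar_part A (polar_part A).
  by apply: (@getPex _ (is_polar_part A)); exists phase_op; exact: phase_polar.
set U := polar_part A => -[[linU contU _] kerU AU].
have UD F G : U (F + G) = U F + U G.
  by have := linU 1 F G; rewrite !scale1r.
have rangeU F Y : mulop (fun x => p x `^ 2^-1) (F, Y) -> U Y = phase_op Y.
  move=> FY.
  have : opcomp (opgraph phase_op) (opabs A) (F, phase_op Y).
    by exists Y => //; rewrite wcomp_opabs.
  have [_ _ <-] := phase_polar; rewrite AU => -[Y'].
  rewrite wcomp_opabs /opgraph/= => FY' ->; congr U.
  by have [sv _ _] := @mulop_linear _ _ _ mu (fun x => p x `^ 2^-1);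
    exact: (sv F).
have kernelU F : restr B F = 0 -> U F = phase_op F.
  move=> BF; have UF : phase_op F = 0.
    by apply: nrm2_eq0; rewrite phase_op_nrm2 BF nrm20.
  rewrite UF; apply/kerU; have [_ kerU0 _] := phase_polar.
  exact/kerU0.
(* Since 0^-1 = 0, a function supported in {p^-1 <= n} is the sum of one
   supported in {p = 0} and of one in the range of multiplication by sqrt p;
   these functions are dense. *)
pose r x := (p x)^-1; have mr : measurable_fun setT r.
  rewrite (_ : r = fun x => p x `^ (-1)); first exact: mpow.
  by apply/funext => x; rewrite powR_inv1.
have mD (n : nat) : measurable [set x | r x <= n%:R].
  by rewrite -[X in measurable X]setTI; exact: measurable_fun_le.
have denseU F n : U (restr [set x | r x <= n%:R] F) =
    phase_op (restr [set x | r x <= n%:R] F).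
  set Fn := restr _ F; rewrite -(subrK (restr B Fn) Fn) UD.
  have -> : phase_op (Fn - restr B Fn + restr B Fn) =
      phase_op (Fn - restr B Fn) + phase_op (restr B Fn).
    by have := phase_op_linear 1 (Fn - restr B Fn) (restr B Fn); rewrite !scale1r.
  congr (_ + _).
    by apply: kernelU; rewrite restrB// restr_idem// subrr.
  pose s x := p x `^ (- 2^-1).
  have sF : mulop s (Fn, toL2 mu (fun x => (s x)%:C * Fn x)).
    (* On the support of [Fn] the square of [s] is p^-1 <= n. *)
    apply: (@mulop_bounded _ _ _ _ _ _ (Num.sqrt n%:R)); first exact: mpow.
    apply: filterS (restrE F (mD n)) => x ->; rewrite indicE.
    case: (boolP (x \in [set x | r x <= n%:R])) => [|_]; last by rewrite mul0r eqxx.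
    rewrite inE/= => rx _; rewrite ger0_norm ?powR_ge0//.
    by rewrite -[s x]ger0_norm ?powR_ge0// -sqrtr_sqr ler_wsqrtr// sqr_powRN_half.
  apply: (rangeU (toL2 mu (fun x => (s x)%:C * Fn x))).
  apply: filterS2 sF (restrE Fn mB) => x /= -> ->; rewrite mulrA -rmorphM/=.
  congr (_%:C * _); rewrite indicE; have [px|px] := ltP 0 (p x).
    by rewrite mem_set// mulrC powRN_half_mul.
  have -> : p x = 0 by apply/eqP; rewrite eq_le px p0.
  by rewrite memNset ?powR0 ?mul0r//= ltNge px.
apply/funext => F; apply/eqP; rewrite -subr_eq0; apply/eqP/nrm2_eq0.
apply/eqP; rewrite eq_le nrm2_ge0 andbT leNgt; apply/negP => e0.
set e := nrm2 _ in e0.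
(* Both errors are made smaller than e/4; the inequality |x + y|^2 <= 2 |x|^2 + 2 |y|^2 then yields
   e < e. *)
have e4 : 0 < e / 4 by rewrite divr_gt0.
have /nbhs_nrm2P[t t0 tU] : nbhs F (U @^-1` [set G | nrm2 (U F - G) < e / 4]).
  by apply: contU; apply/nbhs_nrm2P; exists (e / 4).
have rt0 : 0 < Num.min t (e / 4) by rewrite lt_min t0.
have [n /(_ _ (leqnn n))] := restr_cvg F mr rt0; rewrite lt_min => /andP[/tU /= Un en].
have := nrm2D_le (U F - U (restr [set x | r x <= n%:R] F))
  (phase_op (restr [set x | r x <= n%:R] F) - phase_op F).
rewrite -denseU addrA subrK -/e [X in _ + 2 * X]nrm2B.
have := phase_op_contraction F (restr [set x | r x <= n%:R] F).
rewrite -denseU; move: Un en e0; lra.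
Qed.

Definition aluthge_weight (a : R) x : R[i] :=
  w x * ((p x / p (phi x)) `^ (a / 2))%:C.

(** The phase is everywhere defined, so the only domain conditions are that F is in the domain of
    p^((1 - a)/2) and that the final product is in L2. Where w is nonzero, p o phi is positive and
    its exponents -1/2 and (1 - a)/2 add up to -a/2. *)
Lemma aluthge_wcomp (a : R) : aluthge a A =
  [set q | opdom (mulop (fun x => p x `^ ((1 - a) / 2)) : set (L2 mu * L2 mu)) q.1 /\
    wcomp mu (aluthge_weight a) phi q].
Proof.
have half b : oppower (opabs A) b = mulop (fun x => p x `^ (b / 2)) :> set (L2 mu * L2 mu).
  rewrite wcomp_opabs oppower_mulop//; last by move=> x; exact: powR_ge0.
  by congr mulop; apply/funext => x; rewrite -powRrM mulrC.
rewrite /aluthge !half polar_part_wcomp.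
have key F Y : mulop (fun x => p x `^ ((1 - a) / 2)) (F, Y) ->
    {ae mu, forall x, (p x `^ (a / 2))%:C * phase_op Y x =
       aluthge_weight a x * F (phi x)}.
  move=> FY; have := composition_ae mphi mw mEp Ep0 wp FY => /= FYphi.
  apply: filterS2 (phase_opE Y) (filterI w_support FYphi) => x -> [wpos wY].
  have [w0|wn0] := eqVneq (w x) 0.
    by rewrite /phase /aluthge_weight w0 !mul0r mulr0.
  have y0 := wpos wn0; rewrite wY// /phase /aluthge_weight powR_divM// ?p0//.
  rewrite (_ : - (a / 2) = - 2^-1 + (1 - a) / 2); last by field.
  rewrite powRD ?(gt_eqF y0) ?implybT//.
  rewrite !rmorphM/=; ring.
apply/seteqP; split => -[F G].
  move=> [Z [Y FY]]; rewrite /opgraph/= => -> YG; split; first by exists Y.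
  by apply/wcompE; apply: filterS2 YG (key _ _ FY) => x /= -> ->.
move=> [[Y /= FY]] /wcompE FG; exists (phase_op Y); first by exists Y.
by apply: filterS2 FG (key _ _ FY) => x -> ->.
Qed.

End weighted_composition.

(** * Finiteness and comparison of densities *)

Lemma ae_lty d (X : measurableType d) (R : realType)
    (mu : {measure set X -> \bar R}) (f : X -> \bar R) :
  measurable_fun setT f -> (forall x, 0 <= f x)%E ->
  (\int[mu]_x f x < +oo)%E -> {ae mu, forall x, (f x < +oo)%E}.
Proof.
move=> mf f0 foo; have fi : mu.-integrable setT f.
  by apply/integrableP; split => //; under eq_integral do rewrite gee0_abs//.
by have := integrable_ae measurableT fi; apply: filterS => x /(_ I); rewrite ge0_fin_numE.
Qed.

Section density_criteria.
Context d (X : measurableType d) (R : realType)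
  (mu : {sigma_finite_measure set X -> \bar R}).

(** Otherwise {h = +oo} contains a set T of positive finite measure, and every function of the
    domain vanishes on T: the distance from the indicator of T to the domain is at least its
    norm. *)
Lemma densely_defined_lty (phi : X -> X) (w : X -> R[i]) (h : X -> \bar R) :
  measurable_fun setT phi -> cmeasurable w ->
  measurable_fun setT h -> (forall x, 0 <= h x)%E ->
  (forall A, measurable A ->
    \int[mu]_(x in phi @^-1` A) (sqmod (w x))%:E = \int[mu]_(x in A) h x)%E ->
  densely_defined (wcomp mu w phi) -> {ae mu, forall x, (h x < +oo)%E}.
Proof.
move=> mphi mw mh h0 wh dw; set S := [set x | h x = +oo%E].
have mS : measurable S by have := mh measurableT _ (emeasurable_set1 +oo%E); rewrite setTI.
have [S0|S0] := eqVneq (mu S) 0%E.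
  exists S; split => // x /=; rewrite ltey => /negP; rewrite negbK.
  by move/eqP.
have [T [mT TS T0 Too _]] : exists T, [/\ measurable T, T `<=` S, (0 < mu T)%E,
    (mu T < +oo)%E & (\int[mu]_(x in T) 0 < +oo)%E].
  by apply: (@sigma_finite_subset _ _ _ mu S (cst 0%E) mS S0) => // x _; exact: ltry.
pose f x : R[i] := (\1_T x : R)%:C.
have f2 : (\int[mu]_x (sqmod (f x))%:E = mu T)%E.
  rewrite -[in RHS](setIT T) -integral_indic//; apply: eq_integral => x _.
  by rewrite /f sqmod_real indicE; case: (_ \in _); rewrite ?expr1n ?expr0n.
have mf : cmeasurable f by apply: cmeasurable_real; exact: measurable_indic.
have fE : {ae mu, forall x, toL2 mu f x = f x}.
  by apply: toL2E; split => //; rewrite f2.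
have nf : (nrm2 (toL2 mu f))%:E = mu T.
  by rewrite -sqint_nrm2 -f2; apply: sqint_ae => //; exact: cmeasurable_L2.
have nf0 : 0 < nrm2 (toL2 mu f) by rewrite -lte_fin nf.
pose O := [set G : L2 mu | nrm2 (toL2 mu f - G) < nrm2 (toL2 mu f)].
have fO : (O^°)%classic (toL2 mu f).
  by apply/nbhs_nrm2P; exists (nrm2 (toL2 mu f)).
have [|G [/interior_subset /= OG]] := dw O^° _ (@open_interior _ O).
  by exists (toL2 mu f).
rewrite (wcomp_opdom mphi mw mh h0 wh) /= => Goo.
have mG := measurable_L2_sqmod G.
have Gfin : {ae mu, forall x, ((sqmod (L2_fun G x))%:E * h x < +oo)%E}.
  apply: ae_lty Goo; first exact: emeasurable_funM.
  by move=> x; rewrite mule_ge0// lee_fin sqmod_ge0.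
suff : nrm2 (restr T (toL2 mu f - G)) = nrm2 (toL2 mu f).
  move=> TG; have := nrm2_restr_le (toL2 mu f - G) mT.
  by rewrite TG leNgt => /negP; exact.
congr nrm2; apply: eq_L2.
have h1 := L2_aeB (toL2 mu f) G.
apply: filterS2 (filterI fE h1) (filterI (restrE (toL2 mu f - G) mT) Gfin).
move=> x [fx fG] [-> +]; rewrite fG fx /f indicE.
case: (boolP (x \in T)) => [|_ _]; last by rewrite mul0r.
rewrite inE => /TS hx; rewrite hx => Gx; rewrite mul1r.
suff -> : L2_fun G x = 0 by rewrite subr0.
apply: sqmod_eq0; apply/eqP; rewrite eq_le sqmod_ge0 andbT leNgt; apply/negP => Gp.
by move: Gx; rewrite gt0_muley ?lte_fin// ltxx.
Qed.

Lemma weighted_inclusion_bound (a : X -> R) (b : X -> \bar R) :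
  measurable_fun setT a -> (forall x, 0 <= a x) ->
  measurable_fun setT b -> (forall x, 0 <= b x)%E ->
  (forall F : L2 mu, (\int[mu]_x ((sqmod (F x))%:E * b x) < +oo)%E ->
    (\int[mu]_x (a x * sqmod (F x))%:E < +oo)%E) ->
  exists2 c : R, 0 < c & {ae mu, forall x, ((a x)%:E <= c%:E * (1 + b x))%E}.
Proof.
move=> ma a0 mb b0 incl; apply: contrapT => nc.
have maE : measurable_fun setT (fun x => (a x)%:E) by exact/measurable_EFinP.
pose k x := (1 + b x)%E.
have mk : measurable_fun setT k by exact: emeasurable_funD.
have k0 x : (0 <= k x)%E by rewrite adde_ge0.
have k1 x : (1 <= k x)%E by rewrite leeDl.
pose S (n : nat) := [set x | (a x)%:E > (4 ^+ n)%:E * k x]%E.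
have mS n : measurable (S n).
  rewrite -[X in measurable X]setTI; apply: measurable_lte => //.
  exact: measurable_funeM.
have S0 n : mu (S n) != 0%E.
  apply/eqP => Sn0; apply: nc; exists (4 ^+ n); first by rewrite exprn_gt0.
  exists (S n); split => // x /= /negP; rewrite -ltNge; exact.
(* Here it matters that [a] is real-valued: a real number exceeding 4^n k forces k to be finite, as
   the choice of a subset with finite integral requires. *)
have kS n x : S n x -> (k x < +oo)%E.
  rewrite /S/= ltey; apply: contraTneq => ->.
  by rewrite gt0_muley ?lte_fin ?exprn_gt0.
have /choice[T TP] : forall n, exists T, [/\ measurable T, T `<=` S n,
    (0 < mu T)%E, (mu T < +oo)%E & (\int[mu]_(x in T) k x < +oo)%E].
  by move=> n; exact: (sigma_finite_subset (mS n) (S0 n) mk k0 (@kS n)).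
have mT n : measurable (T n) by case: (TP n).
pose K n := fine (\int[mu]_(x in T n) k x).
have KE n : (\int[mu]_(x in T n) k x)%E = (K n)%:E.
  rewrite fineK// ge0_fin_numE; first by case: (TP n).
  by apply: integral_ge0.
have K0 n : 0 < K n.
  rewrite -lte_fin -KE; have [_ _ mu0 _ _] := TP n; apply: lt_le_trans mu0 _.
  rewrite -[leLHS]mul1e -integral_cst//; apply: ge0_le_integral => //.
  exact: measurable_funTS.
(* F is built so that |F|^2 = \sum_n c_n 1_{T_n}, with T_n inside the set where
   a > 4^n (1 + b): then \int |F|^2 (1 + b) <= 1, while \int |F|^2 a is at least
   4^n c_n \int_{T_n} (1 + b) = 2^n / 2 for every n. *)
pose c n : R := 1 / (2 ^ n.+1)%:R / K n.
have c0 n : 0 <= c n by rewrite !divr_ge0// ltW.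
pose u n x : \bar R := ((c n)%:E * (\1_(T n) x : R)%:E)%E.
have u0 n x : (0 <= u n x)%E by rewrite mule_ge0// lee_fin.
have mu' n : measurable_fun setT (u n).
  by apply: emeasurable_funM => //; apply/measurable_EFinP; exact: measurable_indic.
pose s x := (\sum_(n <oo) u n x)%E.
have s0 x : (0 <= s x)%E by apply: nneseries_ge0.
have ms : measurable_fun setT s by apply: ge0_emeasurable_sum.
have intT (l : X -> \bar R) n : measurable_fun setT l -> (forall x, 0 <= l x)%E ->
    (\int[mu]_x (u n x * l x) = (c n)%:E * \int[mu]_(x in T n) l x)%E.
  move=> ml l0; rewrite [in RHS]integral_mkcond -ge0_integralZl//.
  - by apply: eq_integral => x _; rewrite epatch_indic/= /u -muleA; congr (_ * _)%E; rewrite muleC.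
  - by apply/(measurable_restrict _ (mT n) measurableT); rewrite setTI; exact: measurable_funTS.
  - by move=> x _; rewrite patchE; case: ifP.
  - by rewrite lee_fin.
have sk : (\int[mu]_x (s x * k x) < +oo)%E.
  apply: (@le_lt_trans _ _ 1%E); last exact: ltry.
  have -> : (\int[mu]_x (s x * k x) = \sum_(n <oo) \int[mu]_x (u n x * k x))%E.
    rewrite -integral_nneseries//.
    - apply: eq_integral => x _; have [kfin|kfin] := boolP (k x \is a fin_num).
        rewrite muleC -(fineK kfin) -nneseriesZl; last by move=> j _; exact: u0.
        by apply: eq_eseriesr => j _; rewrite muleC.
      (* Where k is infinite, x lies in no [T n], and both sides vanish by the convention that 0
         times [+oo] is 0. *)
      have un0 n : u n x = 0%E.
        rewrite /u indicE memNset ?mule0// => Tx; move/negP: kfin; apply.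
        rewrite ge0_fin_numE//; apply: (kS n).
        by have [_ TS _ _ _] := TP n; exact: TS.
      rewrite /s !eseries0 ?mul0e// => n _ _; rewrite un0 ?mul0e//.
    - by move=> n; exact: emeasurable_funM.
    - by move=> n x _; rewrite mule_ge0.
  apply: le_trans (epsilon_trick0 xpredT (@ler01 R)).
  apply: lee_nneseries => [n _ _|n _]; first by apply: integral_ge0 => x _; rewrite mule_ge0.
  by rewrite intT// KE -EFinM lee_fin /c divfK// gt_eqF.
have sfin : {ae mu, forall x, (s x < +oo)%E}.
  have := ae_lty (emeasurable_funM ms mk) (fun x => mule_ge0 (s0 x) (k0 x)) sk.
  apply: filterS => x; apply: le_lt_trans.
  by rewrite -[leLHS]mule1 lee_pmul.
pose f x : R[i] := (Num.sqrt (fine (s x)))%:C.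
have fs x : sqmod (f x) = fine (s x) by rewrite sqmod_real sqr_sqrtr// fine_ge0.
have mf : cmeasurable f.
  apply: cmeasurable_real; apply: measurableT_comp; last exact: measurableT_comp.
  by apply: continuous_measurable_fun; exact: sqrt_continuous.
have fsE (l : X -> \bar R) : measurable_fun setT l -> (forall x, 0 <= l x)%E ->
    (\int[mu]_x ((sqmod (f x))%:E * l x) = \int[mu]_x (s x * l x))%E.
  move=> ml l0; apply: ge0_ae_eq_integral => //.
  - by apply: emeasurable_funM => //; exact: measurable_sqmod.
  - exact: emeasurable_funM.
  - by move=> x _; rewrite mule_ge0// lee_fin sqmod_ge0.
  - by move=> x _; rewrite mule_ge0.
  - by apply: filterS sfin => x sx _; rewrite fs fineK// ge0_fin_numE.
have fl2 : square_integrable mu f.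
  split => //; apply: le_lt_trans sk; rewrite -fsE//.
  apply: ge0_le_integral => //.
  - by move=> x _; rewrite lee_fin sqmod_ge0.
  - exact: measurable_sqmod.
  - by apply: emeasurable_funM => //; exact: measurable_sqmod.
  - by move=> x _; rewrite -[leLHS]mule1 lee_pmul// lee_fin sqmod_ge0.
have FE := toL2E fl2; set F := toL2 mu f in FE.
have Fl (l : X -> \bar R) : measurable_fun setT l -> (forall x, 0 <= l x)%E ->
    (\int[mu]_x ((sqmod (F x))%:E * l x) = \int[mu]_x (s x * l x))%E.
  move=> ml l0; rewrite -fsE//; apply: ge0_ae_eq_integral => //.
  - by apply: emeasurable_funM => //; exact: measurable_L2_sqmod.
  - by apply: emeasurable_funM => //; exact: measurable_sqmod.
  - by move=> x _; rewrite mule_ge0// lee_fin sqmod_ge0.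
  - by move=> x _; rewrite mule_ge0// lee_fin sqmod_ge0.
  - by apply: filterS FE => x ->.
have : (\int[mu]_x (s x * (a x)%:E) < +oo)%E.
  rewrite -Fl//; under eq_integral do rewrite -EFinM mulrC.
  apply: incl; rewrite Fl//; apply: le_lt_trans sk; apply: ge0_le_integral => //.
  - by move=> x _; rewrite mule_ge0.
  - exact: emeasurable_funM.
  - exact: emeasurable_funM.
  - by move=> x _; rewrite lee_wpmul2l// leeDr.
have large (n : nat) :
    (((2 ^ n)%:R / 2 : R)%:E <= \int[mu]_x (s x * (a x)%:E))%E.
  apply: (@le_trans _ _ (\int[mu]_x (u n x * (a x)%:E))%E); last first.
    apply: ge0_le_integral => //.
    - by move=> x _; rewrite mule_ge0// lee_fin.
    - exact: emeasurable_funM.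
    - exact: emeasurable_funM.
    - move=> x _; rewrite lee_wpmul2r ?lee_fin//.
      rewrite /s (@nneseriesD1 R (u^~ x) n xpredT (fun j _ => u0 j x) isT).
      by rewrite leeDl// nneseries_ge0.
  rewrite intT//.
  apply: (@le_trans _ _ ((c n)%:E * ((4 ^+ n)%:E * (K n)%:E))%E).
    rewrite -!EFinM lee_fin /c.
    have cK (M D L : R) : D != 0 -> L != 0 -> 1 / D / L * (M * L) = M / D.
      by move=> D0 L0; field; rewrite D0.
    rewrite cK ?(gt_eqF (K0 n)) ?pnatr_eq0 ?expn_eq0//.
    rewrite (_ : 4 ^+ n = (2 ^ n)%:R * (2 ^ n)%:R :> R); last first.
      by rewrite -natrM -expnMn natrX.
    rewrite expnSr natrM -[leRHS]mulrA ler_pM2l ?ltr0n ?expn_gt0//.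
    by rewrite invfM mulrA divff ?mul1r// pnatr_eq0 expn_eq0.
  rewrite lee_wpmul2l ?lee_fin// -KE -ge0_integralZl//; last first.
    exact: measurable_funTS.
  apply: ge0_le_integral => //.
  - by move=> x _; rewrite mule_ge0// lee_fin exprn_ge0.
  - by apply: measurable_funTS; exact: measurable_funeM.
  - exact: measurable_funTS.
  - by move=> x Tx; apply/ltW; have [_ TS _ _ _] := TP n; exact: TS.
move: large; case: (\int[mu]_x _)%E => [r| |] //.
(* This n exceeds 2 r, and 2^n exceeds n. *)
- move=> large _; have := large (Num.truncn (2 * r)).+1.
  rewrite lee_fin leNgt => /negP; apply.
  rewrite ltr_pdivlMr// mulrC; apply: lt_le_trans (truncnS_gt _) _.
  by rewrite ler_nat ltnW// ltn_expl.
- by move=> /(_ 0%N).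
Qed.

End density_criteria.

(** * The Aluthge transform *)

Section aluthge_closure.
Context d (X : measurableType d) (R : realType) (mu : {measure set X -> \bar R}).
Variables (w : X -> R[i]) (mw : cmeasurable w).
Variables (phi : X -> X) (mphi : measurable_fun setT phi).
Variables (p : X -> R) (mp : measurable_fun setT p) (p0 : forall x, 0 <= p x).
Hypothesis wp : forall A, measurable A ->
  (\int[mu]_(x in phi @^-1` A) (sqmod (w x))%:E = \int[mu]_(x in A) (p x)%:E)%E.
Variable a : R.
Implicit Types F G : L2 mu.
Local Notation wa := (aluthge_weight w phi p a).

Let mEp : measurable_fun setT (fun x => (p x)%:E).
Proof. exact/measurable_EFinP. Qed.

Let Ep0 x : (0 <= (p x)%:E)%E. Proof. by rewrite lee_fin. Qed.

Let mpow r : measurable_fun setT (fun x => p x `^ r).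
Proof. exact: (measurableT_comp (@measurable_powR R r) mp). Qed.

Let ratio x := (p x / p (phi x)) `^ (a / 2).

Let ratioE x : ratio x = p x `^ (a / 2) * p (phi x) `^ (- (a / 2)).
Proof. by rewrite /ratio powR_divM. Qed.

Let mratio : measurable_fun setT ratio.
Proof.
rewrite (_ : ratio = fun x => p x `^ (a / 2) * p (phi x) `^ (- (a / 2))).
  apply: measurable_funM => //.
  exact: (measurableT_comp (mpow _) mphi).
by apply/funext => x; rewrite ratioE.
Qed.

Lemma cmeasurable_aluthge_weight : cmeasurable wa.
Proof. by apply: cmeasurableM => //; exact: cmeasurable_real. Qed.

(* On A n the weight wa is dominated by n |w| and p o phi by n, so that
   convergence in L2 passes to the limit there; the sets A n cover X. This does
   not require the density attached to wa to be finite. *)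
Lemma wcomp_closure : closure (wcomp mu wa phi) `<=` wcomp mu wa phi.
Proof.
suff H F G : closure (wcomp mu wa phi) (F, G) -> wcomp mu wa phi (F, G).
  by move=> [F G]; exact: H.
move=> /closure_graphP cl; apply/wcompE.
pose A (n : nat) := [set x | `|ratio x| <= n%:R] `&` [set x | p (phi x) <= n%:R].
have mpphi : measurable_fun setT (p \o phi) by exact: measurableT_comp.
have mple (n : nat) : measurable [set x | p x <= n%:R].
  by rewrite -[X in measurable X]setTI; exact: measurable_fun_le.
have mA n : measurable (A n).
  apply: measurableI; rewrite -[X in measurable X]setTI; last exact: measurable_fun_le.
  apply: measurable_fun_le => //.
  by apply: measurableT_comp => //; exact: normr_measurable.
suff H : {ae mu, forall x, forall n, A n x -> G x = wa x * F (phi x)}.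
  apply: filterS H => x; set n := (Num.truncn (Num.max `|ratio x| (p (phi x)))).+1.
  have := ltW (truncnS_gt (Num.max `|ratio x| (p (phi x)))).
  by rewrite ge_max => /andP[x1 x2] /(_ n); apply; split.
apply/ae_foralln => n.
pose f x : R[i] := (\1_(A n) x)%:C * (G x - wa x * F (phi x)).
have mf : cmeasurable f.
  apply: cmeasurableM; first by apply: cmeasurable_real; exact: measurable_indic.
  have mwF := cmeasurable_weighted mphi cmeasurable_aluthge_weight F.
  have := cmeasurableP (-1) mwF (cmeasurable_L2 G).
  by congr cmeasurable; apply/funext => x /=; rewrite addrC; congr (_ + _);
    rewrite -[LHS]/(-1 * _) mulN1r.
suff f0 : sqint mu f = 0%E.
  apply: filterS (sqint_eq0 mf f0) => x + Ax; rewrite /f indicE mem_set// mul1r.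
  by move/eqP; rewrite subr_eq0 => /eqP.
(* The term 2 bounds the contribution of G - G'. In 2 n^3, a factor n^2 bounds the square of [ratio]
   on [A n], and the last n bounds p after the change of variables. *)
pose C : R := 2 + 2 * n%:R ^+ 3.
have C0 : 0 < C by rewrite ltr_wpDr// mulr_ge0// exprn_ge0.
have fC (r : R) : 0 < r -> (sqint mu f <= (C * r)%:E)%E.
  move=> r0; have [F' [G' [/wcompE FG' Fr Gr]]] := cl r r0.
  pose dF : L2 mu := F - F'; pose dG : L2 mu := G - G'.
  pose u x := \1_[set y | p y <= n%:R] x * sqmod (dF x).
  have mFF := measurable_sqmod_fun (cmeasurable_L2 dF).
  have mGG := measurable_sqmod_fun (cmeasurable_L2 dG).
  have mu' : measurable_fun setT u.
    by apply: measurable_funM => //; exact: measurable_indic.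
  have u0 x : 0 <= u x by rewrite mulr_ge0// sqmod_ge0.
  have muw : measurable_fun setT (fun x => u (phi x) * sqmod (w x)).
    apply: measurable_funM; first exact: (measurableT_comp mu' mphi).
    exact: measurable_sqmod_fun.
  have Hu : (\int[mu]_x (u (phi x) * sqmod (w x))%:E <= (n%:R * r)%:E)%E.
    have -> : (\int[mu]_x (u (phi x) * sqmod (w x))%:E =
        \int[mu]_x ((u x)%:E * (p x)%:E))%E.
      rewrite -(ge0_integral_composition mphi mw mEp Ep0 wp (u := EFin \o u))//.
      exact/measurable_EFinP.
    apply: (@le_trans _ _ (n%:R%:E * sqint mu dF)%E).
      rewrite -ge0_integralZl//; last 2 first.
      - exact/measurable_EFinP.
      - by move=> x _; rewrite lee_fin sqmod_ge0.
      apply: ge0_le_integral => //.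
      - by move=> x _; rewrite -EFinM lee_fin mulr_ge0.
      - by apply: emeasurable_funM => //; exact/measurable_EFinP.
      - by apply: measurable_funeM; exact/measurable_EFinP.
      - move=> x _; rewrite -!EFinM lee_fin /u indicE mulrC mulrA.
        apply: ler_wpM2r; first exact: sqmod_ge0.
        case: (boolP (_ \in _)) => [|_]; last by rewrite mulr0.
        by rewrite inE/= mulr1.
    rewrite sqint_nrm2 -EFinM lee_fin ler_wpM2l//; exact: ltW.
  apply: (@le_trans _ _ (2%:E * \int[mu]_x (sqmod (dG x))%:E +
      (2 * n%:R ^+ 2)%:E * \int[mu]_x (u (phi x) * sqmod (w x))%:E)%E).
    rewrite -ge0_integral_lincomb//; last 2 first.
    - by move=> x; exact: sqmod_ge0.
    - by move=> x; rewrite mulr_ge0// sqmod_ge0.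
    have rhs_ge0 z x : 0 <= 2 * sqmod z + 2 * n%:R ^+ 2 * (u (phi x) * sqmod (w x)).
      apply: addr_ge0; first by rewrite mulr_ge0// sqmod_ge0.
      apply: mulr_ge0; first by apply: mulr_ge0 => //; exact: exprn_ge0.
      by apply: mulr_ge0; [exact: u0|exact: sqmod_ge0].
    have cc := composition_ae mphi mw mEp Ep0 wp (L2_aeB F F').
    apply: ae_ge0_le_integral => //.
    - by move=> x _; rewrite lee_fin sqmod_ge0.
    - exact: measurable_sqmod.
    - by move=> x _; rewrite lee_fin; exact: rhs_ge0.
    - by apply/measurable_EFinP; apply: measurable_funD; apply: measurable_funM.
    apply: filterS2 (filterI FG' (L2_aeB G G')) cc => x [G'x GG'x] FF'x _.
    rewrite lee_fin GG'x G'x /f indicE.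
    case: (boolP (x \in A n)) => [|_]; last first.
      by rewrite mul0r sqmod0; exact: rhs_ge0.
    rewrite inE => -[/= rn pn]; rewrite mul1r.
    rewrite (_ : G x - wa x * F (phi x) = (G x - wa x * L2_fun F' (phi x)) +
      - (wa x * (F (phi x) - L2_fun F' (phi x)))); last by ring.
    apply: le_trans (sqmodD_le _ _) _; rewrite lerD2l sqmodN -[leRHS]mulrA.
    rewrite ler_wpM2l// /u indicE mem_set// mul1r.
    have [w0|wn0] := eqVneq (w x) 0.
      by rewrite /aluthge_weight w0 !mul0r sqmod0 !mulr0.
    rewrite /dF FF'x// /aluthge_weight -/(ratio x) !sqmodM sqmod_real.
    move: (sqmod (w x)) (sqmod_ge0 (w x)) (sqmod (F _ - _))
      (sqmod_ge0 (F (phi x) - L2_fun F' (phi x))) => s s0 l l0.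
    rewrite (_ : s * _ * l = ratio x ^+ 2 * (l * s)); last by ring.
    rewrite ler_wpM2r ?mulr_ge0//.
    by rewrite -(real_normK (num_real (ratio x))) lerXn2r ?nnegrE.
  rewrite -/(sqint mu dG) sqint_nrm2.
  apply: (@le_trans _ _ (2%:E * r%:E + (2 * n%:R ^+ 2)%:E * (n%:R * r)%:E)%E).
    apply: leeD; first by rewrite -!EFinM lee_fin ler_wpM2l// ltW.
    by rewrite lee_wpmul2l// lee_fin mulr_ge0// exprn_ge0.
  rewrite -!EFinM -EFinD lee_fin.
  by rewrite (_ : C * r = 2 * r + 2 * n%:R ^+ 2 * (n%:R * r))// /C; ring.
apply/eqP; rewrite eq_le sqint_ge0 andbT; apply/lee_addgt0Pr => r r0.
rewrite add0e; apply: le_trans (fC (r / C) (divr_gt0 r0 C0)) _.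
by rewrite lee_fin mulrC divfK// gt_eqF.
Qed.

(** F is cut to {p <= n} and G to the preimage of this set under phi, so the cut pair is still in
    the graph. The bound [c n] puts the cut F in the domain of multiplication by [q]. *)
Lemma wcomp_core (q : X -> R) (c : nat -> R) : measurable_fun setT q ->
  (forall n x, p x <= n%:R -> `|q x| <= c n) ->
  wcomp mu wa phi `<=`
  closure [set z | opdom (mulop q : set (L2 mu * L2 mu)) z.1 /\ wcomp mu wa phi z].
Proof.
move=> mq qc [F G] /wcompE FG; apply/closure_graphP => r r0.
have mpphi : measurable_fun setT (p \o phi) by exact: measurableT_comp.
have [n1 N1] := restr_cvg F mp r0; have [n2 N2] := restr_cvg G mpphi r0.
pose n := maxn n1 n2.
have mple (h : X -> R) : measurable_fun setT h -> measurable [set x | h x <= n%:R].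
  by move=> mh; rewrite -[X in measurable X]setTI; exact: measurable_fun_le.
exists (restr [set x | p x <= n%:R] F), (restr [set x | p (phi x) <= n%:R] G).
split; [|by apply: N1; rewrite leq_maxl|by apply: N2; rewrite leq_maxr].
split => /=.
  eexists; apply: (mulop_bounded (c := c n)) => //.
  apply: filterS (restrE F (mple _ mp)) => x ->; rewrite indicE.
  case: (boolP (x \in [set x | p x <= n%:R])) => [|_]; last by rewrite mul0r eqxx.
  by rewrite inE/= => /qc.
apply/wcompE.
have cc := composition_ae mphi mw mEp Ep0 wp (restrE F (mple _ mp)).
apply: filterS2 (filterI FG (restrE G (mple _ mpphi))) cc => x [Gx ->] Fx.
have [w0|wn0] := eqVneq (w x) 0.
  by rewrite Gx /aluthge_weight w0 !mul0r mulr0.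
by rewrite Fx// Gx mulrCA !indicE.
Qed.

(* h_{phi,wa} = (E(h^a) o phi^-1) h^(1 - a). *)
Section density.
Variables (h : X -> \bar R) (e g : X -> \bar R).
Hypotheses (mh : measurable_fun setT h) (h0 : forall x, (0 <= h x)%E).
Hypothesis hfin : {ae mu, forall x, (h x < +oo)%E}.
Hypothesis hp : forall x, p x = fine (h x).
Hypothesis eP : is_cond_exp (weighted_measure mu mw) phi
  (fun x => poweR (h x) a) e.
Hypothesis gP : is_comp_inv mu (weighted_measure mu mw) phi h e g.

Lemma ge0_integral_weighted_measure (f : X -> \bar R) (A : set X) :
  measurable A -> measurable_fun setT f -> (forall x, 0 <= f x)%E ->
  (\int[weighted_measure mu mw]_(x in A) f x =
   \int[mu]_(x in A) (f x * (sqmod (w x))%:E))%E.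
Proof.
move=> mA mf f0; apply: (ge0_integral_image_density_set (phi := id)) => //.
- exact: measurable_sqmod.
- by move=> x; rewrite lee_fin sqmod_ge0.
Qed.

Let mg : measurable_fun setT g. Proof. by case: gP. Qed.
Let g0 x : (0 <= g x)%E. Proof. by case: gP. Qed.

(** Over the preimage of A, with respect to |w|^2 dmu, the function h^a may be replaced by its
    conditional expectation and then by g o phi; the change of variables turns the latter into g p
    over A. *)
Lemma cond_exp_density A : measurable A ->
  (\int[mu]_(x in phi @^-1` A) (sqmod (w x * (p x `^ (a / 2))%:C))%:E =
   \int[mu]_(x in A) (g x * (p x)%:E))%E.
Proof.
move=> mA.
have mpA : measurable (phi @^-1` A) by rewrite -[_ @^-1` _]setTI; exact: mphi.
have [me e0 eE] := eP; have [_ _ eg _] := gP.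
have mhp : measurable_fun setT (fun x => poweR (h x) a).
  exact: (measurableT_comp (@measurable_poweR R a) mh).
have hp0 x : (0 <= poweR (h x) a)%E by exact: poweR_ge0.
have me' : measurable_fun setT e.
  move=> _ B mB; rewrite setTI; have [C mC <-] := me B mB.
  exact: mphi.
have mgphi : measurable_fun setT (g \o phi) by exact: measurableT_comp.
rewrite -(ge0_integral_composition_set mphi mw mEp Ep0 wp mA mg g0).
transitivity (\int[weighted_measure mu mw]_(x in phi @^-1` A) e x)%E.
  rewrite eE// ge0_integral_weighted_measure//.
  apply: ge0_ae_eq_integral => //.
  - apply: measurable_funTS; apply: measurable_sqmod; apply: cmeasurableM => //.
    exact: cmeasurable_real.
  - by apply: measurable_funTS; apply: emeasurable_funM => //; exact: measurable_sqmod.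
  - by move=> x _; rewrite lee_fin sqmod_ge0.
  - by move=> x _; rewrite mule_ge0// lee_fin sqmod_ge0.
  - apply: filterS hfin => x hx _; rewrite sqmodM sqmod_real sqr_powR// hp.
    by rewrite -[in RHS](@fineK _ (h x)) ?ge0_fin_numE// poweR_EFin muleC.
rewrite -(ge0_integral_weighted_measure mpA mgphi)//; last by move=> x; exact: g0.
apply: ge0_ae_eq_integral => //.
- exact: measurable_funTS.
- exact: measurable_funTS.
- by move=> x _; exact: g0.
- by apply: filterS eg => x egx _; exact: egx.
Qed.

(** The weight is w p^(a/2) times a function of phi x, namely the power -a/2 of p o phi. Its square
    passes through the change of variables as p^(-a), which turns the density g p into g p^(1 -
    a). *)
Lemma aluthge_density A : measurable A ->
  (\int[mu]_(x in phi @^-1` A) (sqmod (wa x))%:E =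
   \int[mu]_(x in A) (g x * (p x `^ (1 - a))%:E))%E.
Proof.
move=> mA.
pose v x : R[i] := w x * (p x `^ (a / 2))%:C.
have mv : cmeasurable v by apply: cmeasurableM => //; exact: cmeasurable_real.
have mgp : measurable_fun setT (fun x => g x * (p x)%:E)%E.
  exact: emeasurable_funM.
have gp0 x : (0 <= g x * (p x)%:E)%E by rewrite mule_ge0.
pose t x : \bar R := ((p x `^ (- (a / 2))) ^+ 2)%:E.
have mt : measurable_fun setT t.
  by apply/measurable_EFinP; exact: measurable_funX.
have t0 x : (0 <= t x)%E by rewrite lee_fin sqr_ge0.
transitivity (\int[mu]_(x in phi @^-1` A) (t (phi x) * (sqmod (v x))%:E))%E.
  apply: eq_integral => x _; rewrite -EFinM; congr EFin.
  rewrite /aluthge_weight -/(ratio x) ratioE /v !sqmodM !sqmod_real; ring.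
rewrite (ge0_integral_composition_set mphi mv mgp gp0 cond_exp_density mA mt t0).
have [_ _ _ gh] := gP.
apply: ge0_ae_eq_integral => //.
- by apply: measurable_funTS; exact: emeasurable_funM.
- by apply: measurable_funTS; apply: emeasurable_funM => //; exact/measurable_EFinP.
- by move=> x _; rewrite mule_ge0.
- by move=> x _; rewrite mule_ge0// lee_fin powR_ge0.
apply: filterS2 gh hfin => x /(_ I) gx hx _.
(* The normalization of g is used where p = 0: for [a = 1] the factor p^(1 - a) is 1 there, so g
   itself has to vanish. *)
have [px|px] := ltP 0 (p x); last first.
  suff -> : g x = 0%E by rewrite !mul0e mule0.
  rewrite gx indicE memNset ?mule0//= => hx0; move: px; rewrite hp leNgt => /negP.
  by apply; rewrite fine_gt0// hx0.
rewrite muleCA; congr (_ * _)%E; rewrite -EFinM; congr EFin.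
rewrite -mulNr sqr_powR// powRD; last by rewrite (gt_eqF px) implybT.
by rewrite powRr1// mulrC.
Qed.

End density.
End aluthge_closure.

Theorem theorem4 (R : realType) (d : measure_display) (X : measurableType d)
  (mu : {sigma_finite_measure set X -> \bar R})
  (w : X -> R[i]) (mw : cmeasurable w)
  (phi : X -> X) (mphi : measurable_fun setT phi)
  (ac : pushforward (weighted_measure mu mw) phi `<< mu)
  (h : X -> \bar R)
  (hP : is_radon_nikodym mu (pushforward (weighted_measure mu mw) phi) h)
  (alpha : R) (alpha_gt0 : 0 < alpha) (alpha_le1 : alpha <= 1)
  (dd : densely_defined (wcomp mu w phi))
  (e : X -> \bar R)
  (eP : is_cond_exp (weighted_measure mu mw) phi
          (fun x => poweR (h x) alpha) e)
  (g : X -> \bar R)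
  (gP : is_comp_inv mu (weighted_measure mu mw) phi h e g)
  (walpha : X -> R[i]) (mwalpha : cmeasurable walpha)
  (walphaP : walpha =
    (fun x => w x * ((fine (h x) / fine (h (phi x))) `^ (alpha / 2))%:C)
    %[ae mu]) :
  [/\ opdom (aluthge alpha (wcomp mu w phi)) =
        L2_weight mu (fun x => 1 + poweR (h x) (1 - alpha) +
                               g x * poweR (h x) (1 - alpha))%E,
      aluthge alpha (wcomp mu w phi) `<=` wcomp mu walpha phi,
      closable (aluthge alpha (wcomp mu w phi)) /\
        closure (aluthge alpha (wcomp mu w phi)) = wcomp mu walpha phi,
      aluthge alpha (wcomp mu w phi) = wcomp mu walpha phi <->
        (exists2 c : R, 0 < c & \forall x \ae mu,
          (poweR (h x) (1 - alpha) <=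
             c%:E * (1 + g x * poweR (h x) (1 - alpha)))%E) &
      closed (aluthge alpha (wcomp mu w phi)) <->
        (exists2 c : R, 0 < c & \forall x \ae mu,
          (poweR (h x) (1 - alpha) <=
             c%:E * (1 + g x * poweR (h x) (1 - alpha)))%E)].
Proof.
have [mh h0 hE] := hP.
have hfin : {ae mu, forall x, (h x < +oo)%E}.
  exact: densely_defined_lty mphi mw mh h0 hE dd.
pose p x := fine (h x).
have mp : measurable_fun setT p by exact: measurableT_comp.
have p0 x : 0 <= p x by exact: fine_ge0.
have hpE : {ae mu, forall x, h x = (p x)%:E}.
  by apply: filterS hfin => x hx; rewrite fineK// ge0_fin_numE.
have wp A : measurable A -> (\int[mu]_(x in phi @^-1` A) (sqmod (w x))%:E =
    \int[mu]_(x in A) (p x)%:E)%E.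
  move=> mA; transitivity (\int[mu]_(x in A) h x)%E; first exact: hE.
  apply: ge0_ae_eq_integral => //.
  - exact: measurable_funTS.
  - by apply: measurable_funTS; exact/measurable_EFinP.
  - by move=> x _; rewrite lee_fin.
  - by apply: filterS hpE => x.
pose wa := aluthge_weight w phi p alpha.
have mwa : cmeasurable wa by exact: cmeasurable_aluthge_weight.
have -> : wcomp mu walpha phi = wcomp mu wa phi.
  apply/seteqP; split => -[F G] /wcompE FG; apply/wcompE;
    by apply: filterS2 FG walphaP => x -> /(_ I) ->.
have [mg g0 _ _] := gP.
pose a x := p x `^ (1 - alpha); pose b x := (g x * (a x)%:E)%E.
have ma : measurable_fun setT a.
  exact: (measurableT_comp (@measurable_powR R (1 - alpha)) mp).
have a0 x : 0 <= a x by exact: powR_ge0.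
have mb : measurable_fun setT b.
  by apply: emeasurable_funM => //; exact/measurable_EFinP.
have b0 x : (0 <= b x)%E by rewrite mule_ge0// lee_fin.
have haE : {ae mu, forall x, poweR (h x) (1 - alpha) = (a x)%:E}.
  by apply: filterS hpE => x ->; rewrite poweR_EFin.
have wab A := @aluthge_density _ _ _ mu w mw phi mphi p mp p0 wp alpha h e g
  mh h0 hfin (fun=> erefl) eP gP A.
have domwa := wcomp_opdom mphi mwa mb b0 wab.
pose q x := p x `^ ((1 - alpha) / 2).
have mq : measurable_fun setT q.
  exact: (measurableT_comp (@measurable_powR R ((1 - alpha) / 2)) mp).
have domq : opdom (mulop q : set (L2 mu * L2 mu)) =
    [set F : L2 mu | (\int[mu]_x (a x * sqmod (F x))%:E < +oo)%E].
  rewrite mulop_opdom//.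
  have qE F : (\int[mu]_x (q x ^+ 2 * sqmod (F x))%:E =
      \int[mu]_x (a x * sqmod (F x))%:E)%E.
    by apply: eq_integral => x _; rewrite sqr_powR.
  by apply/seteqP; split => F /=; rewrite qE.
have alE := aluthge_wcomp mw mphi mp p0 wp alpha.
rewrite alE.
set Al := [set z | _].
have Alsub : Al `<=` wcomp mu wa phi by move=> z [].
have clwa : closure (wcomp mu wa phi) `<=` wcomp mu wa phi by exact: wcomp_closure.
have clAl : closure Al = wcomp mu wa phi.
  apply/seteqP; split; first by apply: subset_trans clwa; exact: closure_subset.
  have := @wcomp_core _ _ _ mu w mw phi mphi p mp p0 wp alpha q.
  move=> /(_ (fun n => n%:R `^ ((1 - alpha) / 2)) mq); apply.
  move=> n x pn; rewrite ger0_norm ?powR_ge0//.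
  by apply: ge0_ler_powR => //; rewrite ?nnegrE// divr_ge0// subr_ge0.
(* Equality means that the domain of C_{phi,wa}, given by the weight b, is contained in that of
   p^((1 - alpha)/2), given by the weight a. *)
have bound : Al = wcomp mu wa phi <->
    exists2 c : R, 0 < c & \forall x \ae mu,
      (poweR (h x) (1 - alpha) <= c%:E * (1 + g x * poweR (h x) (1 - alpha)))%E.
  split=> [AlC|[c c0 ca]].
    have [c c0 ca] : exists2 c : R, 0 < c &
        {ae mu, forall x, ((a x)%:E <= c%:E * (1 + b x))%E}.
      apply: (weighted_inclusion_bound ma a0 mb b0) => F Fb.
      have : opdom (wcomp mu wa phi) F by rewrite domwa.
      move=> [G FG]; have [/= + _] : Al (F, G) by rewrite AlC.
      by rewrite domq.
    by exists c => //; apply: filterS2 ca haE => x + ->.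
  suff H (F G : L2 mu) : wcomp mu wa phi (F, G) ->
      opdom (mulop q : set (L2 mu * L2 mu)) F.
    by apply/seteqP; split => // -[F G] FG; split => //=; exact: H FG.
  move=> FG; have : opdom (wcomp mu wa phi) F by exists G.
  rewrite domwa domq/= => Fb.
  have mF := measurable_L2_sqmod F.
  have maE : measurable_fun setT (fun x => (a x)%:E) by exact/measurable_EFinP.
  have Fsq0 x : (0 <= (sqmod (F x))%:E)%E by rewrite lee_fin sqmod_ge0.
  apply: (@le_lt_trans _ _
    (c%:E * \int[mu]_x ((sqmod (F x))%:E + (sqmod (F x))%:E * b x))%E).
    rewrite -ge0_integralZl//; last 3 first.
    - by apply: emeasurable_funD => //; exact: emeasurable_funM.
    - by move=> x _; rewrite adde_ge0// mule_ge0.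
    - by rewrite lee_fin ltW.
    apply: ae_ge0_le_integral => //.
    - by move=> x _; rewrite lee_fin mulr_ge0// sqmod_ge0.
    - by apply/measurable_EFinP; apply: measurable_funM => //; apply/measurable_EFinP.
    - move=> x _; apply: mule_ge0; first by rewrite lee_fin ltW.
      by rewrite adde_ge0// mule_ge0.
    - apply: measurable_funeM; apply: emeasurable_funD => //.
      exact: emeasurable_funM.
    apply: filterS2 ca haE => x + hx _; rewrite hx => ax.
    rewrite mulrC EFinM -[X in (_ <= _ * (X + _))%E]mule1.
    rewrite -ge0_muleDr// muleCA; exact: lee_wpmul2l.
  rewrite ge0_integralD//; last 2 first.
  - by move=> x _; rewrite mule_ge0.
  - exact: emeasurable_funM.
  rewrite -/(sqint mu F) sqint_nrm2 lte_mul_pinfty// ?lee_fin ?ltW//.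
  by rewrite lte_add_pinfty// ltry.
split => //.
- have mhp : measurable_fun setT (fun x => poweR (h x) (1 - alpha)).
    exact: (measurableT_comp (@measurable_poweR R (1 - alpha)) mh).
  (* The three summands of the weight express membership in L2, in the domain of p^((1 - alpha)/2)
     and in the domain of C_{phi,wa}. *)
  have rhoE (F : L2 mu) : (\int[mu]_x ((sqmod (F x))%:E *
        (1 + poweR (h x) (1 - alpha) + g x * poweR (h x) (1 - alpha))) =
      sqint mu F + \int[mu]_x (a x * sqmod (F x))%:E +
      \int[mu]_x ((sqmod (F x))%:E * b x))%E.
    have mF := measurable_L2_sqmod F.
    have Fsq0 x : (0 <= (sqmod (F x))%:E)%E by rewrite lee_fin sqmod_ge0.
    have aF0 x : (0 <= (a x * sqmod (F x))%:E)%E.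
      by rewrite lee_fin mulr_ge0// sqmod_ge0.
    have maF : measurable_fun setT (fun x => (a x * sqmod (F x))%:E).
      by apply/measurable_EFinP; apply: measurable_funM => //; apply/measurable_EFinP.
    have bF0 x : (0 <= (sqmod (F x))%:E * b x)%E by rewrite mule_ge0.
    have mbF : measurable_fun setT (fun x => (sqmod (F x))%:E * b x)%E.
      exact: emeasurable_funM.
    rewrite /sqint -!ge0_integralD//; last 2 first.
    - by move=> x _; rewrite adde_ge0.
    - exact: emeasurable_funD.
    apply: ge0_ae_eq_integral => //.
    - apply: emeasurable_funM => //; apply: emeasurable_funD.
        exact: emeasurable_funD.
      exact: emeasurable_funM.
    - by apply: emeasurable_funD => //; exact: emeasurable_funD.
    - by move=> x _; rewrite mule_ge0// !adde_ge0// ?mule_ge0// poweR_ge0.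
    - by move=> x _; rewrite !adde_ge0.
    have aE0 x : (0 <= (a x)%:E)%E by rewrite lee_fin.
    apply: filterS haE => x -> _; rewrite !ge0_muleDr ?adde_ge0 ?mule_ge0//.
    by rewrite mule1 -EFinM [sqmod _ * _]mulrC.
  apply/seteqP; split => F; rewrite /L2_weight/= rhoE sqint_nrm2.
    move=> [G [/= + FG]]; rewrite domq/= => Fa.
    have : opdom (wcomp mu wa phi) F by exists G.
    rewrite domwa/= => Fb; apply: lte_add_pinfty => //.
    by apply: lte_add_pinfty => //; exact: ltry.
  have Fb0 : (0 <= \int[mu]_x ((sqmod (L2_fun F x))%:E * b x))%E.
    by apply: integral_ge0 => x _; rewrite mule_ge0// lee_fin sqmod_ge0.
  have Fa0 : (0 <= \int[mu]_x (a x * sqmod (L2_fun F x))%:E)%E.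
    by apply: integral_ge0 => x _; rewrite lee_fin mulr_ge0// sqmod_ge0.
  move=> Foo.
  have Fa : (\int[mu]_x (a x * sqmod (L2_fun F x))%:E < +oo)%E.
    apply: le_lt_trans Foo; apply: (le_trans _ (leeDl _ Fb0)).
    by rewrite leeDr// lee_fin nrm2_ge0.
  have : opdom (wcomp mu wa phi) F.
    rewrite domwa/=; apply: le_lt_trans Foo; rewrite leeDr// adde_ge0//.
    by rewrite lee_fin nrm2_ge0.
  by move=> [G FG]; exists G; split => //=; rewrite domq.
- split => //; rewrite /closable clAl.
  by have [] := wcomp_linear mphi mwa mb b0 wab.
(* The closure of [Al] being C_{phi,wa}, closedness is the same as equality with that operator. *)
- rewrite -bound; split => [cl|AlC].
    by rewrite -clAl; exact/closure_id.
  by rewrite AlC -clAl; exact: closed_closure.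
Qed.
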